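(* For every fixed $m$, $\theta>0$ and simplex weight vector $\boldsymbol w$, if $\boldsymbol U=(U_1,\dots,U_m)$ has uniform$(0,1)$ margins and the $m$-variate Clayton copula with parameter $\theta$, and $Y_i=1/U_i$, then as $t\to\infty$ $$\Pr\!\left(\sum_iw_iY_i>t\right)=\frac1t+D_{\theta,\boldsymbol w}\,t^{-1-\theta}+o(t^{-1-\theta}).$$ Moreover, $$D_{\theta,\boldsymbol w}=\frac{a_\theta}{\theta+1}\,\mathbb E\!\left[(m-1)A_{\boldsymbol w}^{\theta+1}-\sum_{i=1}^m(A_{\boldsymbol w}-w_iE_i^{p})^{\theta+1}\right].$$ It is strictly positive when at least two weights are positive and is zero for a single active coordinate (exactly one nonzero weight).
   Context: Simplex weights: $w_i\ge0$, $\sum_iw_i=1$. The $m$-variate Clayton copula is $C_{\theta,m}(u_1,\dots,u_m)=\big(\sum_{i=1}^mu_i^{-\theta}-m+1\big)^{-1/\theta}$. Let $E_1,\dots,E_m$ be i.i.d. $\operatorname{Exp}(1)$ and put $p=1/\theta$, $a_\theta=\Gamma(1+1/\theta)^{-1}$, $b_\theta=(1+\theta)^{-1}$, $A_{\boldsymbol w}=\sum_iw_iE_i^{p}$, $B_{\boldsymbol w}=p\sum_iw_iE_i^{p-1}$, and $$D_{\theta,\boldsymbol w}=a_\theta\,\mathbb E\!\left[A_{\boldsymbol w}^{\theta}(B_{\boldsymbol w}-b_\theta A_{\boldsymbol w})\right].$$ *)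

(* Defs.v *)
From mathcomp Require Import all_boot all_order all_algebra.
From mathcomp Require Import all_classical all_reals all_analysis.

Set Implicit Arguments.
Unset Strict Implicit.
Unset Printing Implicit Defensive.

Import Order.TTheory GRing.Theory Num.Theory.
Import numFieldNormedType.Exports.

Local Open Scope classical_set_scope.
Local Open Scope ring_scope.

(* Makes the Landau notations available at [+oo]. *)
Canonical pinfty_filter_on (R : numFieldType) :=
  FilterType (pinfty_nbhs R) _.

Section Defs.
Context {R : realType}.

Definition simplex (m : nat) (w : 'I_m -> R) : Prop :=
  (forall i, 0 <= w i) /\ \sum_(i < m) w i = 1.

(* On the faces where some [u i = 0] the convention is [0 ^ (-theta) = +oo],
   hence the value 0; the guard is needed because [0 `^ (-theta) = 0]. *)
Definition clayton (theta : R) (m : nat) (u : 'I_m -> R) : R :=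
  if [exists i, u i == 0] then 0
  else (\sum_(i < m) u i `^ (- theta) - m%:R + 1) `^ (- theta^-1).

(* Sklar's identity: the joint distribution function of [X] is the copula [C]
   applied to the marginal distribution functions. *)
Definition has_copula d (T : measurableType d) (P : probability T R)
    (m : nat) (X : 'I_m -> {RV P >-> R}) (C : ('I_m -> R) -> R) : Prop :=
  forall x : 'I_m -> R,
    P [set s | forall i, X i s <= x i]
      = (C (fun i => fine (cdf (X i) (x i))))%:E.

(* Laws are compared on measurable sets only: the right-hand side is meant to
   be a Borel measure, whose values on other sets are irrelevant. *)
Definition has_law d (T : measurableType d) (P : probability T R)
    (X : {RV P >-> R}) (mu : set R -> \bar R) : Prop :=
  forall A : set R, measurable A -> distribution P X A = mu A.

Definition mutually_independent d (T : measurableType d) (P : probability T R)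
    (m : nat) (X : 'I_m -> {RV P >-> R}) : Prop :=
  forall (J : {set 'I_m}) (B : 'I_m -> set R),
    (forall i, measurable (B i)) ->
    P [set s | forall i, i \in J -> B i (X i s)]
      = (\prod_(i in J) P (X i @^-1` B i))%E.

Definition iid_exp1 d (T : measurableType d) (P : probability T R)
    (m : nat) (X : 'I_m -> {RV P >-> R}) : Prop :=
  mutually_independent X /\ forall i, has_law (X i) (exponential_prob 1).

Definition Gamma (s : R) : R :=
  \int[lebesgue_measure]_(x in `]0, +oo[) (x `^ (s - 1) * expR (- x)).

Definition a_ (theta : R) : R := (Gamma (1 + theta^-1))^-1.

Definition b_ (theta : R) : R := (1 + theta)^-1.

Section AB.
Context d (T : measurableType d) (P : probability T R).
Variables (theta : R) (m : nat) (w : 'I_m -> R) (E : 'I_m -> {RV P >-> R}).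

Definition Aw (s : T) : R := \sum_(i < m) w i * E i s `^ theta^-1.

Definition Bw (s : T) : R :=
  theta^-1 * \sum_(i < m) w i * E i s `^ (theta^-1 - 1).

Definition D_integrand (s : T) : R :=
  Aw s `^ theta * (Bw s - b_ theta * Aw s).

Definition D_coef : R := a_ theta * fine 'E_P[D_integrand].

Definition D_integrand_alt (s : T) : R :=
  (m%:R - 1) * Aw s `^ (theta + 1)
  - \sum_(i < m) (Aw s - w i * E i s `^ theta^-1) `^ (theta + 1).

End AB.
End Defs.

(* Main.v *)
From HB Require Import structures.
Require Import Defs.
From mathcomp Require Import all_boot all_order all_algebra.
From mathcomp Require Import all_classical all_reals all_analysis.
From mathcomp Require Import measurable_realfun ring lra.

(** Marshall-Olkin: if [Z] has density [a_ theta * expR (- z `^ theta)] on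
    [z > 0] and is independent of the [E i], then
    [1 / U i = (Z `^ theta + E i) `^ (1 / theta) / Z] in law.  Given [E], the event
    [t < \sum_i w i / U i] is therefore [0 < Z < z], where [t z = phi (z `^ theta)]
    and [phi v = \sum_i w i * (v + E i) `^ (1 / theta)].  As [phi 0 = Aw] and
    [phi' 0 = Bw], expanding this root and the distribution function of [Z] to
    second order gives
    [P (Z < z | E) = a_ theta * (Aw / t + Aw `^ theta * (Bw - b_ theta * Aw) *
    t `^ (- 1 - theta)) + o (t `^ (- 1 - theta))];
    the error is dominated by [(\sum_i E i) * Bw] and powers of [\sum_i E i], so
    expectations can be taken by dominated convergence.  Integrating
    [Aw `^ theta * Bw] by parts in each [E i] against the exponential law yields
    the second formula for [D_coef], whose integrand is nonnegative by superadditivity of [x `^ (theta + 1)]. *)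

Set Implicit Arguments.
Unset Strict Implicit.
Unset Printing Implicit Defensive.

Import Order.TTheory GRing.Theory Num.Theory.
Import numFieldNormedType.Exports.

Local Open Scope classical_set_scope.
Local Open Scope ring_scope.

(** * Laws of random vectors *)

(** [has_copula] prescribes only the probabilities of lower orthants. These form a pi-system, so
    they determine the law of [U], and the tail may be computed on the product of the space of the
    [E i] with an auxiliary law [nu] of Z. This model is the right one because Z^theta is gamma
    distributed with shape 1/theta, and its Laplace transform (1 + c)^(-1/theta) is the inverse of
    the Clayton generator u^(-theta) - 1. Conditioning is on [E] and not on Z: the section in Z is
    then an interval starting at 0 with a small endpoint, so only the density of Z near 0 matters.
    The leading coefficient is 1 because a_theta E[Aw] = 1. The obstacle is the factor E_i^(p-1) in
    [Bw], with p = 1/theta, which is singular at 0 when theta > 1. Integration by parts is therefore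
    done by Tonelli, with values in [0, +oo]. Finiteness of E[Aw^(theta+1)] then gives integrability
    of Aw^theta Bw, and from it that of the dominating function, without any estimate of the
    singularity. *)

Section joint_law.
Context {R : realType} {m : nat}.

Definition lower_box (a : 'I_m -> R) : set ('I_m -> R) :=
  [set x | forall i, x i <= a i].

Definition lower_boxes : set (set ('I_m -> R)) := range lower_box.

(** The sigma-algebra is generated by exactly the sets on which Sklar's identity gives
    information. *)
Definition vecR := g_sigma_algebraType lower_boxes.

Lemma lower_boxesI : setI_closed lower_boxes.
Proof.
move=> _ _ [a _ <-] [b _ <-]; exists (fun i => Num.min (a i) (b i)) => //.
apply/seteqP; split => x /=.
  by move=> xab; split=> i; have := xab i; rewrite le_min => /andP[].
by move=> [xa xb] i; rewrite le_min xa xb.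
Qed.

Lemma bigcup_lower_boxes :
  \bigcup_k (lower_box (fun=> k%:R) : set vecR) = setT.
Proof.
rewrite -subTset => x _.
exists (\max_(i < m) (Num.truncn (x i)).+1)%N => //= i.
apply/ltW/(lt_le_trans (truncnS_gt _)); rewrite ler_nat.
exact: (@leq_bigmax _ (fun i => (Num.truncn (x i)).+1) i).
Qed.

Lemma measurable_coord (i : 'I_m) : measurable_fun setT (fun x : vecR => x i).
Proof.
apply: (measurability _ (RGenOInfty.measurableE R)) => _ [_ [a ->] <-].
(* A half-space x_i <= a is a countable union of boxes: bound [a] at [i], bound [k] at every other
   coordinate. *)
rewrite setTI (_ : _ @^-1` _ = ~` \bigcup_k
  (lower_box (fun j => if j == i then a else k%:R) : set vecR)).
  apply: measurableC; apply: bigcupT_measurable => k.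
  by apply: sub_sigma_algebra; exists (fun j => if j == i then a else k%:R).
apply/seteqP; split => x /=; rewrite in_itv/= andbT.
  by move=> ax [k _ /(_ i)]; rewrite eqxx leNgt ax.
rewrite ltNge => H; apply/negP => xa; apply: H.
have : [set: vecR] x by [].
rewrite -bigcup_lower_boxes => -[k _ xk]; exists k => //= j.
by case: eqP => [->|_]; last exact: xk.
Qed.

Section vector.
Context d (T : measurableType d).
Variable X : 'I_m -> T -> R.
Hypothesis mX : forall i, measurable_fun setT (X i).

Definition vec (s : T) : vecR := fun i => X i s.

Lemma measurable_vec : measurable_fun setT vec.
Proof.
apply: (@measurability _ _ _ vecR setT vec lower_boxes) => // _ [_ [a _ <-] <-].
rewrite setTI (_ : _ @^-1` _ = \bigcap_(i in [set: 'I_m]) X i @^-1` `]-oo, a i]).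
  apply: fin_bigcap_measurable => // i _.
  by rewrite -[X in measurable X]setTI; exact: mX.
apply/seteqP; split => s /=.
  by move=> Xa i _; rewrite /= in_itv/=; exact: Xa.
by move=> Xa i; have := Xa i I; rewrite /= in_itv/=.
Qed.

End vector.

(** Boxes are stable under intersection, and the boxes with constant bound [k] exhaust the space
    with finite mass, so the uniqueness theorem for measures applies. *)
Lemma vec_measure_unique (m1 m2 : {measure set vecR -> \bar R}) :
  (forall a, (m1 (lower_box a) < +oo)%E) ->
  (forall a, m1 (lower_box a) = m2 (lower_box a)) ->
  forall B, measurable B -> m1 B = m2 B.
Proof.
move=> fin12 m12; apply: (@measure_unique _ _ vecR lower_boxes
  (fun k => lower_box (fun=> k%:R))) => //.
- exact: lower_boxesI.
- by move=> k; exists (fun=> k%:R).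
- exact: bigcup_lower_boxes.
- by move=> _ [a _ <-]; exact: m12.
Qed.

End joint_law.
Arguments vecR : clear implicits.

(** * Real powers *)

Section powR_calculus.
Context {R : realType}.
Implicit Types x p : R.

Lemma continuous_powR_gt0 x p : 0 < x -> {for x, continuous (fun y : R => y `^ p)}.
Proof.
move=> /(is_derive1_powR p) ?.
by apply: differentiable_continuous; exact/derivable1_diffP.
Qed.

(** The limit 0 is included. The real power is not left-continuous there, which is why [f] has to be
    eventually nonnegative. *)
Lemma cvg_powR {U : Type} (F : set_system U) {FF : Filter F} (f : U -> R) (l q : R) :
  0 < q -> (\forall u \near F, 0 <= f u) -> 0 <= l -> f u @[u --> F] --> l ->
  f u `^ q @[u --> F] --> l `^ q.
Proof.
move=> q0 f0; rewrite le_eqVlt => /predU1P[<-|l0] fl; last first.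
  exact: (cvg_comp _ _ fl (continuous_powR_gt0 l0)).
rewrite powR0 ?gt_eqF//; apply/cvgrPdist_lt => e e0.
have e'0 : 0 < e `^ q^-1 by rewrite powR_gt0.
move/cvgrPdist_lt : fl => /(_ _ e'0) H.
near=> u.
have fu0 : 0 <= f u by near: u.
have : `|0 - f u| < e `^ q^-1 by near: u.
rewrite !sub0r !normrN ger0_norm// ger0_norm ?powR_ge0// => fe.
have -> : e = (e `^ q^-1) `^ q by rewrite -powRrM mulVf ?gt_eqF// powRr1// ltW.
by apply: gt0_ltr_powR => //; rewrite nnegrE// ltW.
Unshelve. all: by end_near. Qed.

End powR_calculus.

(** * Densities *)

Section density.
Context d (T : measurableType d) (R : realType).
Variables (mu nu : {measure set T -> \bar R}) (h : T -> R).
Hypothesis mh : measurable_fun setT h.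
Hypothesis h0 : forall x, 0 <= h x.
Hypothesis nuE : forall A, measurable A -> nu A = (\int[mu]_(x in A) (h x)%:E)%E.
Local Open Scope ereal_scope.

Import HBNNSimple.

Let density_indic E : measurable E ->
  \int[nu]_x (\1_E x)%:E = \int[mu]_x ((\1_E x)%:E * (h x)%:E).
Proof.
move=> mE; rewrite integral_indic// setIT nuE// integral_mkcond.
apply: eq_integral => x _; rewrite patchE indicE.
by case: (x \in E); rewrite ?mul1e ?mul0e.
Qed.

Let density_nnsfun (f : {nnsfun T >-> R}) :
  \int[nu]_x (f x)%:E = \int[mu]_x ((f x)%:E * (h x)%:E).
Proof.
under [LHS]eq_integral do rewrite fimfunE -fsumEFin//.
rewrite [LHS]ge0_integral_fsum//; last 2 first.
  - by move=> r; exact/measurable_EFinP/measurableT_comp.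
  - by move=> n x _; rewrite EFinM nnfun_muleindic_ge0.
under [RHS]eq_integral.
  move=> x xD; rewrite fimfunE -fsumEFin// ge0_mule_fsuml; last first.
    by move=> r; rewrite EFinM nnfun_muleindic_ge0.
  over.
rewrite [RHS]ge0_integral_fsum//; last 2 first.
  - move=> r; apply: emeasurable_funM; [|exact/measurable_EFinP].
    exact/measurable_EFinP/measurableT_comp.
  - by move=> n x _; rewrite EFinM mule_ge0 ?nnfun_muleindic_ge0// lee_fin.
apply: eq_fsbigr => r _.
rewrite integralZl_indic_nnsfun//= density_indic//.
under [RHS]eq_integral do rewrite EFinM -muleA.
(* Pulling [r] out of the integral requires [0 <= r], which holds when [r] is a value of [f];
   otherwise its fibre is empty and both sides vanish. *)
have [/set_mem[x _ <-]|rf] := boolP (r \in range f).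
  rewrite ge0_integralZl//.
  - by apply: emeasurable_funM; exact/measurable_EFinP.
  - by move=> t _; rewrite mule_ge0 ?lee_fin.
  - by rewrite lee_fin.
have -> : f @^-1` [set r] = set0.
  by apply/seteqP; split => // x /= fxr; move/negP: rf; apply; apply/mem_set; exists x.
rewrite !integral0_eq ?mule0// => x _; first by rewrite indicE in_set0 mul0e mule0.
by rewrite indicE in_set0 mul0e.
Qed.

(** Standard extension: indicators, then simple functions, then monotone limits. *)
Lemma ge0_integral_density (f : T -> \bar R) :
  measurable_fun setT f -> (forall x, 0 <= f x) ->
  \int[nu]_x f x = \int[mu]_x (f x * (h x)%:E).
Proof.
move=> mf f0; pose f_ := nnsfun_approx measurableT mf.
transitivity (lim (\int[nu]_x (f_ n x)%:E @[n --> \oo])).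
  rewrite -monotone_convergence//=.
  - by apply: eq_integral => ? _; apply/esym/cvg_lim => //=;
      exact: cvg_nnsfun_approx.
  - by move=> n; exact/measurable_EFinP/measurable_funTS.
  - by move=> n ? _; rewrite lee_fin.
  - by move=> ? _ ? ? mn; rewrite lee_fin; exact/lefP/nd_nnsfun_approx.
transitivity (lim (\int[mu]_x ((f_ n x)%:E * (h x)%:E) @[n --> \oo])).
  by apply/congr_lim/funext => n; exact: density_nnsfun.
rewrite -monotone_convergence//=.
- apply: eq_integral => x _; apply/cvg_lim => //=.
  by apply: cvgeZr => //; exact: cvg_nnsfun_approx.
- move=> n; apply: emeasurable_funM; [|exact/measurable_EFinP].
  exact/measurable_EFinP/measurable_funTS.
- by move=> n ? _; rewrite mule_ge0 ?lee_fin.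
- move=> x _ ? ? mn; apply: lee_wpmul2r; first by rewrite lee_fin.
  by rewrite lee_fin; exact/lefP/nd_nnsfun_approx.
Qed.

End density.

Section density_probability.
Context d (T : measurableType d) (R : realType).
Variables (mu : {measure set T -> \bar R}) (h : T -> R).
Hypothesis mh : measurable_fun setT h.
Hypothesis h0 : forall x, 0 <= h x.
Hypothesis h1 : (\int[mu]_x (h x)%:E = 1)%E.

Let nu (A : set T) : \bar R := (\int[mu]_(x in A) (h x)%:E)%E.

Let nu0 : nu set0 = 0%E. Proof. by rewrite /nu integral_set0. Qed.

Let nu_ge0 A : (0 <= nu A)%E.
Proof. by apply: integral_ge0 => x _; rewrite lee_fin. Qed.

Let nu_sigma_additive : semi_sigma_additive nu.
Proof.
move=> F mF tF mUF; rewrite /nu; apply: cvg_toP.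
  apply: ereal_nondecreasing_is_cvgn => m n mn.
  by apply: lee_sum_nneg_natr => // k _ _; exact: nu_ge0.
rewrite ge0_integral_bigcup//=.
- by apply/measurable_EFinP/measurable_funTS.
- by move=> x _; rewrite lee_fin.
Qed.

HB.instance Definition _ := isMeasure.Build _ _ _ nu
  nu0 nu_ge0 nu_sigma_additive.

Let nuT : nu setT = 1%E. Proof. exact: h1. Qed.

HB.instance Definition _ := @Measure_isProbability.Build _ _ R nu nuT.

Lemma density_probability :
  exists P : probability T R, forall A, P A = (\int[mu]_(x in A) (h x)%:E)%E.
Proof. by exists nu. Qed.

End density_probability.

(** * The fundamental theorem of calculus on a half-open interval *)

Section FTC_open.
Context {R : realType}.
Local Notation leb := (@lebesgue_measure R).
Variables F f : R -> R.
Hypothesis f0 : forall x : R, 0 < x -> 0 <= f x.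
Hypothesis F0 : F x @[x --> 0^'+] --> F 0.
Hypothesis dF : forall x : R, 0 < x -> is_derive x 1 F (f x).
Hypothesis cf : forall x : R, 0 < x -> {for x, continuous f}.

Lemma FTC_measurable : measurable_fun (`]0%R, +oo[ : set R) f.
Proof.
apply: open_continuous_measurable_fun => //.
by move=> x; rewrite inE/= in_itv/= andbT; exact: cf.
Qed.

(** The derivative may blow up at 0, as x^(p-1) does for p < 1. The theorem is applied on compact
    intervals away from 0, and monotone convergence together with right continuity of [F] at 0 gives
    the limit. *)
Lemma ge0_FTC2_open x : 0 < x ->
  (\int[leb]_(y in `]0%R, x]) (f y)%:E = (F x)%:E - (F 0)%:E)%E.
Proof.
move=> x0.
(* With [n.+2] the interval is nondegenerate already for [n = 0]. *)
pose A n : set R := [set` `[x * n.+2%:R^-1, x]].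
have An0 n : 0 < x * n.+2%:R^-1 by rewrite mulr_gt0// invr_gt0.
have Anx n : x * n.+2%:R^-1 < x by rewrite gtr_pMr// invf_lt1// ltr1n.
have UA : `]0, x]%classic = \bigcup_n A n.
  apply/seteqP; split => [y /=|y [n _]]; rewrite /A/= !in_itv/=; last first.
    by move=> /andP[ny ->]; rewrite (lt_le_trans (An0 n) ny).
  move=> /andP[y0 yx]; exists (Num.truncn (x / y)) => //=.
  rewrite in_itv/= yx andbT ler_pdivrMr// -ler_pdivrMl// mulrC.
  apply/ltW/(lt_le_trans (truncnS_gt _)).
  by rewrite ler_nat.
have mAn n : measurable_fun (A n) (EFin \o f).
  apply/measurable_EFinP; apply: measurable_funS FTC_measurable => //.
  move=> y; rewrite /A/= !in_itv/= => /andP[ny _].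
  by rewrite (lt_le_trans (An0 n) ny).
have H : (\int[leb]_(y in A n) (f y)%:E)%E @[n --> \oo] -->
         (\int[leb]_(y in `]0%R, x]) (f y)%:E)%E.
  rewrite UA; apply: ge0_nondecreasing_set_cvg_integral => //.
  - apply/nondecreasing_seqP => n; apply/subsetPset => y.
    rewrite /A/= !in_itv/= => /andP[ny ->]; rewrite andbT.
    by apply: le_trans ny; rewrite ler_pM2l// lef_pV2 ?posrE// ler_nat.
  - move=> n; exact: measurable_itv.
  - move=> n y; rewrite /A/= in_itv/= => /andP[ny _]; rewrite lee_fin f0//.
    exact: lt_le_trans ny.
rewrite -(cvg_lim _ H)//; apply/cvg_lim => //.
rewrite (_ : (fun n => _) =
             (fun n => ((F x)%:E - (F (x * n.+2%:R^-1))%:E)%E)); last first.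
  apply/funext => n; apply: continuous_FTC2 => //.
  - apply: continuous_in_subspaceT => y; rewrite inE/= in_itv/= => /andP[ny _].
    by apply: cf; exact: lt_le_trans ny.
  - have cF y : 0 < y -> {for y, continuous F}.
      by move=> /dF ?; apply: differentiable_continuous; exact/derivable1_diffP.
    split.
    + move=> y; rewrite in_itv/= => /andP[ny _].
      by have /dF : 0 < y by exact: lt_trans ny.
    + by apply: cvg_at_right_filter; exact: cF.
    + by apply: cvg_at_left_filter; exact: cF.
  - move=> y; rewrite in_itv/= => /andP[ny _].
    have /dF ? : 0 < y by exact: lt_trans ny.
    by rewrite derive1E derive_val.
under eq_fun do rewrite -EFinB.
rewrite -EFinB; apply: cvg_EFin; first by apply: nearW.
apply: cvgB; first exact: cvg_cst.
move/cvg_at_rightP : F0; apply; split => //.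
rewrite -[X in _ --> X](mulr0 x); apply: cvgM; first exact: cvg_cst.
have := @cvg_harmonic R; rewrite -(cvg_shiftS (@harmonic R)); exact.
Qed.

End FTC_open.

(** * The exponential law *)

Section exponential_law.
Context {R : realType}.
Local Notation leb := (@lebesgue_measure R).
Variable P : probability (measurableTypeR R) R.
Hypothesis PE : forall A, measurable A -> P A = exponential_prob 1 A.

Lemma exp_law_ccdf (y : R) : 0 <= y -> P [set` `[y, +oo[] = (expR (- y))%:E.
Proof.
move=> y0; rewrite PE// /exponential_prob.
rewrite (@ge0_continuous_FTC2y _ _ (fun x => - (expR (- 1 * x))) _ 0)//.
- by rewrite mulN1r EFinN oppeK add0e.
- by move=> x _; exact: exponential_pdf_ge0.
- apply: (@continuous_subspaceW R R^o _ [set` `[0, +oo[]);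
    last exact: within_continuous_exponential_pdf.
  by move=> x; rewrite /= !in_itv/= !andbT; exact: le_trans.
- rewrite -oppr0; apply: cvgN; under eq_fun do rewrite mulN1r.
  exact: cvgr_expR.
- apply: cvgN; apply/cvg_at_right_filter; apply: continuous_comp.
    by apply: continuousM => //; exact: cvg_cst.
  exact: continuous_expR.
- move=> x; rewrite in_itv/= andbT => yx.
  by apply: derive1_exponential_pdf; rewrite in_itv/= andbT (le_lt_trans y0).
Qed.

Lemma exp_law_occdf (y : R) : 0 <= y -> P [set` `]y, +oo[] = (expR (- y))%:E.
Proof.
move=> y0; rewrite -exp_law_ccdf// !PE// /exponential_prob.
rewrite integral_itv_obnd_cbnd//; apply/measurable_EFinP/measurable_funTS.
exact: measurable_exponential_pdf.
Qed.

Lemma exp_law_gt0 : P [set` `]0, +oo[] = 1%E.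
Proof. by rewrite exp_law_occdf// oppr0 expR0. Qed.

Lemma ge0_integral_exp_law (f : R -> \bar R) :
  measurable_fun setT f -> (forall x, (0 <= f x)%E) ->
  (\int[P]_x f x = \int[leb]_(x in `]0%R, +oo[) (f x * (expR (- x))%:E))%E.
Proof.
move=> mf f0; rewrite (@ge0_integral_density _ _ _ leb P (exponential_pdf 1))//.
- rewrite [RHS]integral_itv_obnd_cbnd; last first.
    apply: emeasurable_funM; first exact: measurable_funTS.
    apply/measurable_EFinP/measurable_funTS; apply: measurableT_comp => //.
  rewrite [RHS]integral_mkcond; apply: eq_integral => x _.
  rewrite /exponential_pdf !patchE; case: ifPn => _; last by rewrite mule0.
  by rewrite mul1r mulN1r.
- exact: measurable_exponential_pdf.
- by move=> x; exact: exponential_pdf_ge0.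
Qed.

Lemma exp_law_moment (q : R) : 0 < q -> (\int[P]_x (x `^ q)%:E < +oo)%E.
Proof.
move=> q0; rewrite ge0_integral_exp_law//; last 2 first.
  by apply/measurable_EFinP; exact: measurable_powR.
  by move=> x; rewrite lee_fin powR_ge0.
(* From 1 + y <= e^y at y = x/(2q) one gets x^q <= (2q)^q e^(x/2), so x^q e^(-x) is at most (2q)^q
   e^(-x/2). The factor 2 turns e^(-x/2) into the exponential density of rate 1/2. *)
pose C := (q *+ 2) `^ q * 2.
have C0 : 0 <= C by rewrite mulr_ge0// powR_ge0.
apply: (@le_lt_trans _ _ (C%:E * \int[leb]_x (exponential_pdf 2^-1 x)%:E)%E);
  last by rewrite integral_exponential_pdf ?invr_gt0// mule1 ltry.
rewrite -ge0_integralZl//; last 2 first.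
  apply/measurable_EFinP; exact: measurable_exponential_pdf.
  by move=> x _; rewrite lee_fin exponential_pdf_ge0// invr_ge0.
rewrite [leLHS]integral_mkcond; apply: ge0_le_integral => //.
- move=> x _; apply: erestrict_ge0 => y _.
  by rewrite -EFinM lee_fin mulr_ge0 ?powR_ge0 ?expR_ge0.
- apply/(measurable_restrictT _ _).1 => //; apply/measurable_funTS.
  apply/measurable_EFinP/measurable_funM; first exact: measurable_powR.
  by apply: measurableT_comp => //; exact: measurable_expR.
- apply/measurable_EFinP/measurable_funM => //.
  exact: measurable_exponential_pdf.
move=> x _; rewrite patchE; case: ifPn => [|_]; last first.
  by rewrite -EFinM lee_fin mulr_ge0// exponential_pdf_ge0// invr_ge0.
rewrite inE/= in_itv/= andbT => x0.
rewrite -!EFinM lee_fin exponential_pdfE ?(ltW x0)//.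
have -> : expR (- 2^-1 * x) = expR (x / 2) * expR (- x).
  by rewrite -expRD; congr expR; lra.
rewrite /C -mulrA (mulrA 2) divff// mul1r mulrA ler_pM2r ?expR_gt0//.
have -> : expR (x / 2) = (expR (x / (q *+ 2))) `^ q.
  by rewrite -expRM; congr expR; field; rewrite gt_eqF.
rewrite -powRM ?expR_ge0 ?mulrn_wge0 ?(ltW q0)//.
apply: ge0_ler_powR; rewrite ?nnegrE ?(ltW q0) ?(ltW x0)//.
  by rewrite mulr_ge0 ?expR_ge0// mulrn_wge0// ltW.
have q20 : 0 < q *+ 2 by rewrite pmulrn_lgt0.
rewrite -ler_pdivrMl// mulrC.
have := expR_ge1Dx (x / (q *+ 2)).
apply: le_trans; lra.
Qed.

Section stein.
Variables F f : R -> R.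
Hypothesis F_ge0 : 0 <= F 0.
Hypothesis F0 : F x @[x --> 0^'+] --> F 0.
Hypothesis dF : forall x : R, 0 < x -> is_derive x 1 F (f x).
Hypothesis cf : forall x : R, 0 < x -> {for x, continuous f}.
Hypothesis mf : measurable_fun setT f.
Hypothesis f0 : forall x : R, 0 <= f x.

(* Tonelli applied to [F x - F 0 = \int_0^x f]. *)
Lemma exp_law_integration_by_parts :
  (\int[P]_(x in `]0%R, +oo[) (F x)%:E = (F 0)%:E + \int[P]_x (f x)%:E)%E.
Proof.
have mf' : measurable_fun setT (EFin \o f) by exact/measurable_EFinP.
transitivity (\int[P]_(x in `]0%R, +oo[)
  ((F 0)%:E + \int[leb]_y ((f y)%:E * (\1_`]0, x] y)%:E)))%E.
  apply: eq_integral => x; rewrite inE/= in_itv/= andbT => x0.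
  have := ge0_FTC2_open (fun y _ => f0 y) F0 dF cf x0.
  rewrite integral_mkcond => H.
  transitivity ((F 0)%:E + ((F x)%:E - (F 0)%:E))%E.
    by rewrite -EFinB -EFinD; congr EFin; lra.
  rewrite -H; congr (_ + _)%E; apply: eq_integral => y _.
  by rewrite patchE indicE; case: ifPn => _; rewrite ?mule1 ?mule0.
pose GG := (measurableTypeR R * measurableTypeR R)%type.
pose g (z : GG) : \bar R :=
  ((f z.2)%:E * (\1_[set z | 0 < z.2 <= z.1] z)%:E)%E.
have mA : measurable [set z : GG | 0 < z.2 <= z.1].
  rewrite [X in measurable X](_ : _ =
    (snd @^-1` `]0, +oo[) `&` [set z : GG | (z.2%:E <= z.1%:E)%E]).
    apply: measurableI.
      by rewrite -[X in measurable X]setTI; apply: measurable_snd.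
    rewrite -[X in measurable X]setTI.
    apply: (@measurable_lee _ GG R setT measurableT (EFin \o snd) (EFin \o fst));
      apply/measurable_EFinP; [exact: measurable_snd|exact: measurable_fst].
  by apply/seteqP; split => z /=; rewrite lee_fin in_itv/= andbT; [move/andP|move=> [-> ->]].
have mg : measurable_fun setT g.
  apply: emeasurable_funM.
    exact: (measurableT_comp mf' measurable_snd).
  by apply/measurable_EFinP/measurable_indic.
have g0 z : (0 <= g z)%E by rewrite /g mule_ge0// lee_fin.
have gE x y : ((f y)%:E * (\1_`]0, x] y)%:E)%E = g (x, y).
  by rewrite /g !indicE; congr (_ * (nat_of_bool _)%:R%:E)%E.
rewrite ge0_integralD//=; last 2 first.
- by move=> x _; apply: integral_ge0 => y _; rewrite mule_ge0// lee_fin.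
- apply: measurable_funTS; under eq_fun do under eq_integral do rewrite gE.
  exact: (@measurable_fun_fubini_tonelli_F _ _ _ _ _ leb g).
rewrite integral_cst// [X in (_ * X)%E]exp_law_gt0 mule1; congr (_ + _)%E.
transitivity (\int[P]_x \int[leb]_y g (x, y))%E.
  rewrite integral_mkcond; apply: eq_integral => x _; rewrite patchE.
  case: ifPn => [_|]; first by apply: eq_integral => y _; rewrite gE.
  rewrite notin_setE/= in_itv/= andbT => /negP; rewrite -leNgt => x0.
  rewrite integral0_eq// => y _; rewrite /g indicE memNset/= ?mule0//.
  by move=> /andP[y0 yx]; move: (lt_le_trans y0 yx); rewrite ltNge x0.
rewrite (@fubini_tonelli _ _ _ _ _ P leb g)// ge0_integral_exp_law//.
rewrite [RHS]integral_mkcond; apply: eq_integral => y _; rewrite patchE.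
case: ifPn => [|].
  rewrite inE/= in_itv/= andbT => y0.
  (* Integrating the triangle 0 < y <= x over x leaves the survival probability e^(-y), which for
     this law equals the density: the outer Lebesgue integral is again an expectation. *)
  transitivity (\int[P]_x ((f y)%:E * (\1_`[y, +oo[ x)%:E))%E.
    apply: eq_integral => x _; rewrite /g !indicE; congr (_ * (nat_of_bool _)%:R%:E)%E.
    by apply/idP/idP; rewrite !inE/= in_itv/= andbT y0.
  rewrite ge0_integralZl//; last 2 first.
    exact/measurable_EFinP/measurable_indic.
    by rewrite lee_fin.
  by rewrite integral_indic// setIT; congr (_ * _)%E; exact: exp_law_ccdf (ltW y0).
rewrite notin_setE/= in_itv/= andbT => /negP; rewrite -leNgt => y0.
rewrite integral0_eq// => x _; rewrite /g indicE memNset/= ?mule0//.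
by rewrite ltNge y0.
Qed.

End stein.
End exponential_law.

(** * Independence *)

Section law.
Context {R : realType} d (T : measurableType d) (Q : probability T R).
Variable X : {RV Q >-> R}.

(* [distribution Q X] lives on the measurable structure of [R], Lebesgue measure
   on that of [measurableTypeR R]: same measurable sets, different displays. *)
Definition law : set (measurableTypeR R) -> \bar R := distribution Q X.

Let law0 : law set0 = 0%E. Proof. exact: measure0. Qed.

Let law_ge0 A : (0 <= law A)%E. Proof. exact: measure_ge0. Qed.

Let law_sigma_additive : semi_sigma_additive law.
Proof. exact: (@measure_semi_sigma_additive _ _ _ (distribution Q X)). Qed.

HB.instance Definition _ := isMeasure.Build _ _ _ law
  law0 law_ge0 law_sigma_additive.

Let lawT : law setT = 1%E. Proof. exact: probability_setT. Qed.

HB.instance Definition _ := @Measure_isProbability.Build _ _ R law lawT.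

Lemma ge0_integral_law (f : measurableTypeR R -> \bar R) :
  measurable_fun setT f -> (forall x, (0 <= f x)%E) ->
  (\int[law]_x f x = \int[Q]_s f (X s))%E.
Proof.
move=> mf f0.
rewrite -[RHS](@ge0_integral_pushforward _ _ _ (measurableTypeR R) R X
  (measurable_funP X) Q setT f)//.
Qed.

End law.

Section independence.
Context {R : realType} {m : nat} d (T : measurableType d) (Q : probability T R).
Variable E : 'I_m -> {RV Q >-> R}.
Hypothesis E_indep : mutually_independent E.
Variable i : 'I_m.

(** Resetting the coordinate to 0 keeps the index type, and since 0^p = 0 it removes exactly one
    term from a weighted sum of p-th powers. *)
Definition drop_coord (s : T) : vecR R m :=
  vec (fun j s => if j == i then 0 else E j s) s.

Lemma measurable_drop_coord : measurable_fun setT drop_coord.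
Proof. by apply: measurable_vec => j; case: (j == i) => //; exact: measurable_cst. Qed.

HB.instance Definition _ :=
  isMeasurableFun.Build _ _ _ _ drop_coord measurable_drop_coord.

Local Open Scope ereal_scope.

(** For fixed [A] both sides are finite measures in [B], so it suffices to compare them on boxes,
    where mutual independence applies twice: to all indices and to all indices but [i]. *)
Lemma coord_drop_coord_indep (A : set R) (B : set (vecR R m)) :
  measurable A -> measurable B ->
  Q ((E i @^-1` A) `&` (drop_coord @^-1` B)) =
  Q (E i @^-1` A) * Q (drop_coord @^-1` B).
Proof.
move=> mA mB.
have mEA : measurable (E i @^-1` A).
  by rewrite -[X in measurable X]setTI; exact: measurable_funP.
pose r := fine (Q (E i @^-1` A)).
have r0 : (0 <= r)%R by exact: fine_ge0.
have rE : Q (E i @^-1` A) = r%:E by rewrite fineK// fin_num_measure.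
pose m1' : {measure set (vecR R m) -> \bar R} :=
  pushforward (mrestr Q mEA) drop_coord.
pose m1 := m1' measurable_drop_coord.
pose m2 : {measure set (vecR R m) -> \bar R} :=
  mscale (NngNum r0) (distribution Q drop_coord).
have : m1 B = m2 B; last first.
  by rewrite /m1 /m1' /m2 /mscale/= /distribution /pushforward /mrestr setIC => ->; rewrite rE.
apply: vec_measure_unique => // a.
  apply: (@le_lt_trans _ _ 1); last exact: ltry.
  rewrite /m1 /m1'/= /pushforward /mrestr; apply: probability_le1.
  by apply: measurableI => //; rewrite -[X in measurable X]setTI;
    apply: measurable_drop_coord => //; apply: sub_sigma_algebra; exists a.
rewrite /m1 /m1' /m2 /= /mscale/= /distribution /pushforward /mrestr.
(* The dropped coordinate is constantly 0, so its bound only decides whether the box is hit at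
   all. *)
have [ai|ai] := leP 0%R (a i); last first.
  have -> : drop_coord @^-1` lower_box a = set0.
    apply/seteqP; split => // s /= /(_ i); rewrite /drop_coord /vec eqxx.
    by rewrite leNgt ai.
  by rewrite set0I measure0 mule0.
pose B' j : set R := if j == i then A else `]-oo, a j]%classic.
have B'i : B' i = A by rewrite /B'; case: eqP.
have mB' j : measurable (B' j) by rewrite /B'; case: (j == i).
have := E_indep (finset.setTfor _) mB'.
have := E_indep (finset.setC (finset.set1 i)) mB'.
rewrite (_ : [set s | _] = drop_coord @^-1` lower_box a); last first.
  apply/seteqP; split => s /= H j.
    rewrite /drop_coord /vec; have [->//|ji] := eqVneq j i.
    have := H j; rewrite !inE ji /B' (negbTE ji) => /(_ isT).
    by rewrite /= in_itv.
  rewrite !inE => ji; have := H j; rewrite /B' /drop_coord /vec (negbTE ji).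
  by rewrite /= in_itv.
move=> ->.
rewrite (_ : [set s | _] = drop_coord @^-1` lower_box a `&` E i @^-1` A).
  move=> ->; rewrite -rE (bigD1 i) ?inE//=; congr (Q _ * _).
    by apply/seteqP; split => x; rewrite /preimage/= B'i.
  by apply: eq_bigl => j; rewrite !inE.
apply/seteqP; split => s /= H.
  split; last by have := H i; rewrite inE B'i; exact.
  move=> j; rewrite /drop_coord /vec; have [->//|ji] := eqVneq j i.
  have := H j; rewrite !inE /B' (negbTE ji) => /(_ isT).
  by rewrite /= in_itv.
move=> j _; have [->|ji] := eqVneq j i; first by rewrite B'i; case: H.
case: H => /(_ j) H _; move: H; rewrite /B' /drop_coord /vec (negbTE ji).
by rewrite /= in_itv.
Qed.

Let dist := law (E i).

(** By independence the pair has a product law, so Tonelli allows [E i] to be integrated out against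
    its own law while the other coordinates stay frozen. *)
Lemma ge0_integral_resample (f : measurableTypeR R * vecR R m -> \bar R) :
  measurable_fun setT f -> (forall z, 0 <= f z) ->
  \int[Q]_s f (E i s, drop_coord s) =
  \int[Q]_s \int[dist]_x f (x, drop_coord s).
Proof.
move=> mf f0.
pose J (s : T) : measurableTypeR R * vecR R m := (E i s, drop_coord s).
have mJ : measurable_fun setT J.
  apply/measurable_fun_pairP; split; first exact: (measurable_funP (E i)).
  exact: measurable_drop_coord.
pose D := distribution Q drop_coord.
pose PJ : {measure set (measurableTypeR R * vecR R m) -> \bar R} :=
  pushforward Q J.
have JE X : measurable X -> (dist \x D) X = pushforward Q J X.
  apply: (product_measure_unique (m' := PJ mJ)) => A B mA mB.
  by rewrite /pushforward/= -coord_drop_coord_indep.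
transitivity (\int[pushforward Q J]_z f z).
  by rewrite ge0_integral_pushforward.
transitivity (\int[dist \x D]_z f z).
  by apply: eq_measure_integral => X mX _; apply/esym; exact: JE.
rewrite fubini_tonelli2// ge0_integral_distribution//.
- exact: measurable_fun_fubini_tonelli_G.
- by move=> y; apply: integral_ge0.
Qed.

End independence.

(** * Powers of [Aw] as functions of a single coordinate *)

Section affine_power.
Context {R : realType}.
Variables (al w p q : R).
Hypotheses (al0 : 0 <= al) (w0 : 0 <= w) (p0 : 0 < p) (q0 : 0 < q).

Lemma is_derive_affine_power (x : R) : 0 < x ->
  is_derive x 1 (fun y => (al + w * y `^ p) `^ q)
    (q * (al + w * x `^ p) `^ (q - 1) * (p * w * x `^ (p - 1))).
Proof.
(* For [w = 0] the base may be 0, where the chain rule fails, but the function is then constant. *)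
move=> x0; move: w0; rewrite le_eqVlt => /predU1P[<-|w_gt0].
  under eq_fun do rewrite mul0r; rewrite mulr0 !mul0r mulr0.
  exact: is_derive_cst.
have dx := is_derive1_powR p x0.
have h0 : 0 < al + w * x `^ p by rewrite ltr_wpDl// mulr_gt0// powR_gt0.
have dh := is_derive1_powR q h0.
have dg : is_derive x 1 (fun y => al + w * y `^ p) (p * w * x `^ (p - 1)).
  by apply: is_derive_eq; rewrite /GRing.scale/=; ring.
have := @is_derive1_comp R (fun y => y `^ q) (fun y => al + w * y `^ p) x _ _ dh dg.
by rewrite [X in is_derive _ _ _ X]mulrC.
Qed.

Lemma cvg_affine_power_at0 :
  (al + w * x `^ p) `^ q @[x --> 0^'+] --> (al + w * 0 `^ p) `^ q.
Proof.
rewrite powR0 ?gt_eqF// mulr0 addr0.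
apply: cvg_powR => //.
  by near=> x; rewrite addr_ge0// mulr_ge0// powR_ge0.
rewrite -[X in _ --> X]addr0; apply: cvgD; first exact: cvg_cst.
rewrite -[X in _ --> X](mulr0 w); apply: cvgM; first exact: cvg_cst.
exact: powR_cvg0.
Unshelve. all: by end_near. Qed.

Lemma continuous_affine_power' (x : R) : 0 < x ->
  {for x, continuous (fun y => q * (al + w * y `^ p) `^ (q - 1) *
                               (p * w * y `^ (p - 1)))}.
Proof.
move=> x0; move: w0; rewrite le_eqVlt => /predU1P[<-|w_gt0].
  by apply: cvg_near_cst; apply: nearW => y; rewrite mulr0 !mul0r !mulr0.
have h0 : 0 < al + w * x `^ p by rewrite ltr_wpDl// mulr_gt0// powR_gt0.
have cg : {for x, continuous (fun y => al + w * y `^ p)}.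
  rewrite /prop_for /continuous_at; apply: cvgD; first exact: cvg_cst.
  by apply: cvgM; [exact: cvg_cst|exact: continuous_powR_gt0].
rewrite /prop_for /continuous_at; apply: cvgM; last first.
  by apply: cvgM; [exact: cvg_cst|exact: continuous_powR_gt0].
apply: cvgM; first exact: cvg_cst.
exact: (cvg_comp _ _ cg (continuous_powR_gt0 h0)).
Qed.

End affine_power.

(** * Integration by parts for powers of [Aw] *)

Section weighted_powers.
Context {R : realType} {m : nat} d (T : measurableType d) (Q : probability T R).
Variable E : 'I_m -> {RV Q >-> R}.
Hypothesis E_iid : iid_exp1 E.
Variables (theta : R) (w : 'I_m -> R).
Hypotheses (theta0 : 0 < theta) (w0 : forall i, 0 <= w i).
Let p := theta^-1.

Let p0 : 0 < p. Proof. by rewrite invr_gt0. Qed.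

Lemma measurable_Aw : measurable_fun setT (Aw theta w E).
Proof.
apply: measurable_sum => i; apply: measurable_funM => //.
exact: (measurableT_comp (measurable_powR _) (measurable_funP (E i))).
Qed.

Lemma measurable_Bw : measurable_fun setT (Bw theta w E).
Proof.
apply: measurable_funM => //.
apply: measurable_sum => i; apply: measurable_funM => //.
exact: (measurableT_comp (measurable_powR _) (measurable_funP (E i))).
Qed.

Lemma Aw_ge0 s : 0 <= Aw theta w E s.
Proof. by apply: sumr_ge0 => i _; rewrite mulr_ge0// powR_ge0. Qed.

Lemma Bw_ge0 s : 0 <= Bw theta w E s.
Proof.
by rewrite mulr_ge0 ?(ltW p0)//; apply: sumr_ge0 => i _; rewrite mulr_ge0// powR_ge0.
Qed.

Lemma Aw_sub_ge0 i s : 0 <= Aw theta w E s - w i * E i s `^ p.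
Proof.
rewrite /Aw (bigD1 i)//= [_ + \sum_(j < m | _) _]addrC addrK.
by apply: sumr_ge0 => j _; rewrite mulr_ge0// powR_ge0.
Qed.

Let al (y : vecR R m) := \sum_(j < m) w j * y j `^ p.

Let mal : measurable_fun setT al.
Proof.
apply: measurable_sum => i; apply: measurable_funM => //.
exact: (measurableT_comp (measurable_powR _) (measurable_coord i)).
Qed.

Let al0 y : 0 <= al y.
Proof. by apply: sumr_ge0 => i _; rewrite mulr_ge0// powR_ge0. Qed.

Let al_drop i s : al (drop_coord E i s) = Aw theta w E s - w i * E i s `^ p.
Proof.
rewrite /al /Aw (bigD1 i)//= [in RHS](bigD1 i)//=.
rewrite /drop_coord /vec eqxx powR0 ?gt_eqF// mulr0 add0r addrAC subrr add0r.
by apply: eq_bigr => j /negbTE ->.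
Qed.

Local Open Scope ereal_scope.

(** With the other variables frozen, Aw^(theta+1) is (al + w_i x^p)^(theta+1) at x = E_i. Its value
    at x = 0 gives the first term and its derivative the second. All terms lie in [0, +oo], so no
    integrability is assumed. *)
Lemma Aw_integration_by_parts i :
  \int[Q]_s (Aw theta w E s `^ (theta + 1))%:E =
  \int[Q]_s ((Aw theta w E s - w i * E i s `^ p) `^ (theta + 1))%:E +
  \int[Q]_s ((theta + 1) * Aw theta w E s `^ theta *
             (p * w i * E i s `^ (p - 1)))%:E.
Proof.
have q0 : (0 < theta + 1)%R by rewrite addr_gt0.
pose X : {RV Q >-> R} := E i.
have PE A : measurable A -> law X A = exponential_prob 1 A by apply: (E_iid.2 i).
pose F (z : measurableTypeR R * vecR R m) := (al z.2 + w i * z.1 `^ p)%R.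
have mF : measurable_fun setT F.
  apply: measurable_funD; first exact: (measurableT_comp mal measurable_snd).
  apply: measurable_funM => //.
  exact: (measurableT_comp (measurable_powR _) measurable_fst).
have F0 z : (0 <= F z)%R by rewrite addr_ge0// mulr_ge0// powR_ge0.
have FE s : F (E i s, drop_coord E i s) = Aw theta w E s.
  by rewrite /F al_drop/= subrK.
pose f1 z := (F z `^ (theta + 1))%:E.
pose f2 z := ((theta + 1) * F z `^ theta * (p * w i * z.1 `^ (p - 1)))%:E.
have mf1 : measurable_fun setT f1.
  by apply/measurable_EFinP; exact: (measurableT_comp (measurable_powR _) mF).
have mf2 : measurable_fun setT f2.
  apply/measurable_EFinP; apply: measurable_funM.
    apply: measurable_funM => //.
    exact: (measurableT_comp (measurable_powR _) mF).
  apply: measurable_funM => //.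
  exact: (measurableT_comp (measurable_powR _) measurable_fst).
have f10 z : 0 <= f1 z by rewrite lee_fin powR_ge0.
have f20 z : 0 <= f2 z.
  by rewrite lee_fin !mulr_ge0 ?powR_ge0 ?(ltW q0) ?(ltW p0).
transitivity (\int[Q]_s f1 (E i s, drop_coord E i s)).
  by apply: eq_integral => s _; rewrite /f1 FE.
rewrite (ge0_integral_resample E_iid.1)//.
transitivity (\int[Q]_s ((al (drop_coord E i s) `^ (theta + 1))%:E +
  \int[law (E i)]_x f2 (x, drop_coord E i s))).
  apply: eq_integral => s _; set y := drop_coord E i s.
  pose G (x : measurableTypeR R) := ((al y + w i * x `^ p) `^ (theta + 1))%R.
  pose g (x : measurableTypeR R) := ((theta + 1) * (al y + w i * x `^ p) `^ (theta + 1 - 1) *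
       (p * w i * x `^ (p - 1)))%R.
  have mG0 : measurable_fun setT (fun x : measurableTypeR R => al y + w i * x `^ p)%R.
    by apply: measurable_funD => //; apply: measurable_funM.
  have mG : measurable_fun setT (EFin \o G).
    by apply/measurable_EFinP; exact: (measurableT_comp (measurable_powR _) mG0).
  have G0 : G 0%R = (al y `^ (theta + 1))%R.
    by rewrite /G powR0 ?gt_eqF// mulr0 addr0.
  have mg : measurable_fun setT g.
    rewrite /g; apply: measurable_funM.
      apply: measurable_funM => //.
      exact: (measurableT_comp (measurable_powR _) mG0).
    by apply: measurable_funM => //; exact: (measurable_powR (p - 1)).
  have Gge0 : (0 <= G 0)%R by rewrite G0 powR_ge0.
  have cG : G x @[x --> 0^'+] --> G 0%R.
    exact: (cvg_affine_power_at0 (al0 y) (w0 i) p0 q0).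
  have dG (x : R) : (0 < x)%R -> is_derive x (1:R)%R (G : R -> R) (g x).
    exact: (is_derive_affine_power p (theta + 1)%R (al0 y) (w0 i)).
  have cg (x : R) : (0 < x)%R -> {for x, continuous (g : R -> R)}.
    by move=> x0; exact: (continuous_affine_power' (q := (theta + 1)%R) (al0 y) (w0 i) x0).
  have g0 x : (0 <= g x)%R by rewrite !mulr_ge0 ?powR_ge0 ?(ltW q0) ?(ltW p0).
  have H := exp_law_integration_by_parts PE Gge0 cG dG cg mg g0.
  rewrite (_ : \int[_]_x f2 _ = \int[law X]_x (g x)%:E); last first.
    by apply: eq_integral => x _; rewrite /f2 /g addrK.
  rewrite -G0 -H.
  rewrite [LHS](_ : _ = \int[law X]_x (G x)%:E)//.
  (* Resampling integrates over the whole line and integration by parts over []0, +oo[]; the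
     complement is null for the exponential law. *)
  rewrite [RHS]integral_mkcond; apply: ge0_ae_eq_integral;
    [exact: measurableT|exact: mG| |by move=> x _; rewrite lee_fin powR_ge0| |].
  - exact/(measurable_restrictT _ _).1/measurable_funTS.
  - by move=> x _; apply: erestrict_ge0 => ? _; rewrite lee_fin powR_ge0.
  exists (~` `]0%R, +oo[%classic); split.
  - exact: measurableC.
  - have := probability_setC (law X) (measurable_itv `]0%R, +oo[).
    by rewrite [X in _ = _ - X](exp_law_gt0 PE) subee.
  - move=> x /= /existsNP[_] H'; apply: contra_not H' => x0.
    by rewrite patchE mem_set.
rewrite ge0_integralD//.
- rewrite [X in _ + X](_ : _ = \int[Q]_s ((theta + 1) * Aw theta w E s `^ theta *
             (p * w i * E i s `^ (p - 1)))%:E).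
    by under eq_integral do rewrite al_drop.
  rewrite -(ge0_integral_resample E_iid.1 i mf2 f20).
  by apply: eq_integral => s _; rewrite /f2 FE.
- by move=> s _; rewrite lee_fin powR_ge0.
- apply/measurable_EFinP; apply: (measurableT_comp (measurable_powR _)).
  exact: (measurableT_comp mal (measurable_drop_coord E i)).
- by move=> s _; apply: integral_ge0.
- have := @measurable_fun_fubini_tonelli_G _ _ _ _ _ (law (E i)) f2 mf2 f20.
  by move=> /measurableT_comp; apply; exact: (measurable_drop_coord E i).
Qed.

End weighted_powers.

(** * Moments *)

(** The sum is at most [m] times its largest term, whose q-th power is one of the summands on the
    right. Unlike convexity, this covers q < 1 as well. *)
Lemma powR_sum_le {R : realType} (m : nat) (a : 'I_m -> R) (q : R) :
  (forall i, 0 <= a i) -> 0 < q ->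
  (\sum_(i < m) a i) `^ q <= m%:R `^ q * \sum_(i < m) a i `^ q.
Proof.
move=> a0 q0; case: m a a0 => [|m] a a0.
  by rewrite !big_ord0 powR0 ?gt_eqF// mulr0.
pose j := [arg max_(i > ord0) a i]%O.
have aj i : a i <= a j by rewrite /j; case: Order.TotalTheory.arg_maxP => // k _ /(_ i isT).
have sj : \sum_(i < m.+1) a i <= m.+1%:R * a j.
  apply: (@le_trans _ _ (\sum_(i < m.+1) a j)); first exact: ler_sum.
  by rewrite sumr_const card_ord mulr_natl.
apply: (@le_trans _ _ ((m.+1%:R * a j) `^ q)).
  by apply: ge0_ler_powR; rewrite ?nnegrE ?(ltW q0) ?sumr_ge0 ?mulr_ge0.
rewrite powRM// ler_wpM2l ?powR_ge0// (bigD1 j)//= lerDl sumr_ge0// => i _.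
exact: powR_ge0.
Qed.

Section moments.
Context {R : realType} {m : nat} d (T : measurableType d) (Q : probability T R).
Variable E : 'I_m -> {RV Q >-> R}.
Hypothesis E_iid : iid_exp1 E.
Variable theta : R.
Hypothesis theta0 : 0 < theta.
Let p := theta^-1.
Let p0 : 0 < p. Proof. by rewrite invr_gt0. Qed.

Lemma exp1_law i A : measurable A -> law (E i) A = exponential_prob 1 A.
Proof. exact: (E_iid.2 i). Qed.

Lemma ae_exp1_gt0 : {ae Q, forall s, forall i, 0 < E i s}.
Proof.
apply: (@filter_forall T _ (fun i s => 0 < E i s) (almost_everywhere Q)) => i.
exists (~` (E i @^-1` `]0, +oo[)); split.
- by apply: measurableC; rewrite -[X in measurable X]setTI; exact: measurable_funP.
- have mE : measurable (E i @^-1` `]0, +oo[).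
    by rewrite -[X in measurable X]setTI; exact: measurable_funP.
  have := probability_setC Q mE.
  have -> : Q (E i @^-1` `]0, +oo[) = 1%E by exact: (exp_law_gt0 (exp1_law i)).
  by rewrite subee.
- by move=> s /= H; rewrite in_itv/= andbT.
Qed.

Lemma exp1_moment i (q : R) : 0 < q -> (\int[Q]_s (E i s `^ q)%:E < +oo)%E.
Proof.
move=> q0; rewrite -(ge0_integral_law (E i) (f := fun x => (x `^ q)%:E)).
- exact: (exp_law_moment (exp1_law i)).
- by apply/measurable_EFinP; exact: measurable_powR.
- by move=> x; rewrite lee_fin powR_ge0.
Qed.

Lemma ge0_integrable (f : T -> R) : measurable_fun setT f ->
  (forall s, 0 <= f s) -> (\int[Q]_s (f s)%:E < +oo)%E ->
  Q.-integrable setT (EFin \o f).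
Proof.
move=> mf f0 fi; apply/integrableP; split; first exact/measurable_EFinP.
by under eq_integral => s _ do rewrite /= ger0_norm//.
Qed.

Lemma measurable_exp_powR i (q : R) : measurable_fun setT (fun s => E i s `^ q).
Proof. exact: (measurableT_comp (measurable_powR _) (measurable_funP (E i))). Qed.

Lemma integrable_exp_powR i (q : R) : 0 < q ->
  Q.-integrable setT (EFin \o (fun s => E i s `^ q)).
Proof.
move=> q0; apply: ge0_integrable; last exact: exp1_moment.
- exact: measurable_exp_powR.
- by move=> s; rewrite powR_ge0.
Qed.

Lemma le_integrableR (f g : T -> R) : measurable_fun setT f ->
  (forall s, `|f s| <= g s) -> Q.-integrable setT (EFin \o g) ->
  Q.-integrable setT (EFin \o f).
Proof.
move=> mf fg; apply: le_integrable => //; first exact/measurable_EFinP.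
by move=> s _; rewrite /= lee_fin (le_trans (fg s))// ler_norm.
Qed.

Lemma integrableRZ (f : T -> R) (c : R) : Q.-integrable setT (EFin \o f) ->
  Q.-integrable setT (EFin \o (fun s => c * f s)).
Proof. by move=> fi; exact: (integrableZl measurableT c fi). Qed.

Lemma integrableR_sum (f : 'I_m -> T -> R) :
  (forall i, Q.-integrable setT (EFin \o f i)) ->
  Q.-integrable setT (EFin \o (fun s => \sum_(i < m) f i s)).
Proof.
move=> fi; rewrite (_ : _ \o _ = fun s => (\sum_(i < m) (f i s)%:E)%E).
  by apply: integrable_sum => // i _; exact: fi.
by apply/funext => s /=; rewrite -sumEFin.
Qed.

(* [`^ 1] is the identity on positive reals and nonnegative everywhere. *)
Definition total (s : T) : R := \sum_(i < m) E i s `^ 1.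

Lemma measurable_total : measurable_fun setT total.
Proof. by apply: measurable_sum => i; exact: measurable_exp_powR. Qed.

Lemma total_ge0 s : 0 <= total s.
Proof. by apply: sumr_ge0 => i _; exact: powR_ge0. Qed.

Lemma integrable_total_powR (q : R) : 0 < q ->
  Q.-integrable setT (EFin \o (fun s => total s `^ q)).
Proof.
move=> q0; apply: (@le_integrableR _
  (fun s => m%:R `^ q * \sum_(i < m) E i s `^ q)).
- exact: (measurableT_comp (measurable_powR _) measurable_total).
- move=> s; rewrite ger0_norm ?powR_ge0//.
  apply: (le_trans (powR_sum_le _ q0)); first by move=> i; exact: powR_ge0.
  by under eq_bigr do rewrite -powRrM mul1r.
- by apply/integrableRZ/integrableR_sum => i; exact: integrable_exp_powR.
Qed.

Section weights.
Variable w : 'I_m -> R.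
Hypothesis w0 : forall i, 0 <= w i.

Lemma integrable_Aw_powR : Q.-integrable setT
  (EFin \o (fun s => Aw theta w E s `^ (theta + 1))).
Proof.
have q0 : 0 < theta + 1 by rewrite addr_gt0.
apply: (@le_integrableR _ (fun s => m%:R `^ (theta + 1) *
    \sum_(i < m) (w i `^ (theta + 1) * E i s `^ (p * (theta + 1))))).
- exact: (measurableT_comp (measurable_powR _) (measurable_Aw _ _ _)).
- move=> s; rewrite ger0_norm ?powR_ge0//.
  apply: (le_trans (powR_sum_le _ q0)).
    by move=> i; rewrite mulr_ge0// powR_ge0.
  by under eq_bigr do rewrite powRM ?powR_ge0// -powRrM.
- apply/integrableRZ/integrableR_sum => i; apply/integrableRZ.
  by apply: integrable_exp_powR; rewrite mulr_gt0.
Qed.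

Lemma integrable_Aw_sub_powR i : Q.-integrable setT
  (EFin \o (fun s => (Aw theta w E s - w i * E i s `^ p) `^ (theta + 1))).
Proof.
have q0 : 0 < theta + 1 by rewrite addr_gt0.
apply: le_integrableR integrable_Aw_powR.
  apply: (measurableT_comp (measurable_powR _)).
  apply: measurable_funB; first exact: measurable_Aw.
  by apply: measurable_funM => //; exact: measurable_exp_powR.
move=> s; rewrite ger0_norm ?powR_ge0//.
apply: ge0_ler_powR; rewrite ?nnegrE ?(ltW q0)// ?Aw_ge0 ?Aw_sub_ge0//.
by rewrite gerBl mulr_ge0// powR_ge0.
Qed.

Let AdA i s := (theta + 1) * Aw theta w E s `^ theta *
             (p * w i * E i s `^ (p - 1)).

(** Integration by parts exhibits this nonnegative integral as part of the finite E[Aw^(theta+1)],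
    which settles the singularity of E_i^(p-1) at 0. *)
Let integrable_AdA i : Q.-integrable setT (EFin \o AdA i).
Proof.
apply: ge0_integrable.
- apply: measurable_funM; apply: measurable_funM => //.
    exact: (measurableT_comp (measurable_powR _) (measurable_Aw _ _ _)).
  exact: measurable_exp_powR.
- by move=> s; rewrite !mulr_ge0 ?powR_ge0 ?(ltW p0)// addr_ge0// ltW.
have := integrable_Aw_powR => /integral_fune_lt_pinfty.
rewrite /= (Aw_integration_by_parts E_iid theta0 w0 i).
move=> /(_ measurableT) H; apply: (le_lt_trans _ H); rewrite leeDr//; apply: integral_ge0 => s _.
by rewrite lee_fin powR_ge0.
Qed.

Let sum_AdA s : \sum_(i < m) AdA i s =
  (theta + 1) * (Aw theta w E s `^ theta * Bw theta w E s).
Proof.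
rewrite -mulr_sumr -mulrA /Bw [in RHS]mulr_sumr; congr (_ * (_ * _)).
by apply: eq_bigr => i _; rewrite mulrA.
Qed.

Lemma integrable_AwBw : Q.-integrable setT
  (EFin \o (fun s => Aw theta w E s `^ theta * Bw theta w E s)).
Proof.
have q0 : theta + 1 != 0 by rewrite gt_eqF// addr_gt0.
rewrite (_ : (fun s => _) = (fun s => (theta + 1)^-1 * \sum_(i < m) AdA i s)).
  by apply/integrableRZ/integrableR_sum => i; exact: integrable_AdA.
by apply/funext => s; rewrite sum_AdA mulKf.
Qed.

Let D_integrandE s : D_integrand theta w E s =
  Aw theta w E s `^ theta * Bw theta w E s -
  (theta + 1)^-1 * Aw theta w E s `^ (theta + 1).
Proof.
rewrite /D_integrand /b_ mulrBr addrC [in RHS]addrC [1 + theta]addrC; congr (- _ + _).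
have [->|A0] := eqVneq (Aw theta w E s) 0.
  by rewrite powR0 ?gt_eqF// powR0 ?gt_eqF ?addr_gt0// !(mul0r, mulr0).
by rewrite powRD ?A0 ?implybT// powRr1 ?Aw_ge0//; ring.
Qed.

Lemma integrable_D_integrand : Q.-integrable setT (EFin \o D_integrand theta w E).
Proof.
rewrite (_ : _ \o _ = fun s => ((Aw theta w E s `^ theta * Bw theta w E s)%:E -
   ((theta + 1)^-1 * Aw theta w E s `^ (theta + 1))%:E)%E).
  apply: integrableB => //; first exact: integrable_AwBw.
  exact/integrableRZ/integrable_Aw_powR.
by apply/funext => s /=; rewrite D_integrandE EFinB.
Qed.

Lemma integrable_D_integrand_alt :
  Q.-integrable setT (EFin \o D_integrand_alt theta w E).
Proof.
rewrite (_ : _ \o _ = fun s => (((m%:R - 1) * Aw theta w E s `^ (theta + 1))%:E -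
   (\sum_(i < m) (Aw theta w E s - w i * E i s `^ theta^-1) `^ (theta + 1))%:E)%E).
  apply: integrableB => //; first exact/integrableRZ/integrable_Aw_powR.
  by apply/integrableR_sum => i; exact: integrable_Aw_sub_powR.
by apply/funext => s /=; rewrite EFinB.
Qed.

Local Notation RI f := (\int[Q]_s (f s))%R.

Lemma Rintegral_sumR (f : 'I_m -> T -> R) :
  (forall i, Q.-integrable setT (EFin \o f i)) ->
  RI (fun s => \sum_(i < m) f i s) = \sum_(i < m) RI (f i).
Proof.
move=> fi; rewrite /Rintegral.
under eq_integral do rewrite -sumEFin.
rewrite integral_sum// -sum_fine// => i _.
by apply: integrable_fin_num => //; exact: fi.
Qed.

(** Summing the integrations by parts over [i] gives (theta+1) E[Aw^theta Bw] as [m] copies of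
    E[Aw^(theta+1)] minus the reduced moments. The term in [b_ theta] removes one copy, hence m -
    1. *)
Lemma expectation_D_integrand : fine 'E_Q[D_integrand theta w E] =
  (theta + 1)^-1 * fine 'E_Q[D_integrand_alt theta w E].
Proof.
have q0 : theta + 1 != 0 by rewrite gt_eqF// addr_gt0.
rewrite !unlock -![fine _]/(RI _).
have iA := integrable_Aw_powR.
have iAi := integrable_Aw_sub_powR.
have ibp i : RI (fun s => Aw theta w E s `^ (theta + 1)) =
  RI (fun s => (Aw theta w E s - w i * E i s `^ p) `^ (theta + 1)) + RI (AdA i).
  rewrite /Rintegral (Aw_integration_by_parts E_iid theta0 w0 i) fineD//.
  - exact: (integrable_fin_num measurableT (iAi i)).
  - exact: (integrable_fin_num measurableT (integrable_AdA i)).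
have -> : RI (D_integrand_alt theta w E) =
  (m%:R - 1) * RI (fun s => Aw theta w E s `^ (theta + 1)) -
  \sum_(i < m) RI (fun s => (Aw theta w E s - w i * E i s `^ p) `^ (theta + 1)).
  rewrite RintegralB//; last 2 first.
    exact: (integrableRZ (m%:R - 1)).
    exact: integrableR_sum.
  by rewrite RintegralZl// Rintegral_sumR.
have -> : RI (D_integrand theta w E) =
  (theta + 1)^-1 * \sum_(i < m) RI (AdA i) -
  (theta + 1)^-1 * RI (fun s => Aw theta w E s `^ (theta + 1)).
  rewrite -Rintegral_sumR; last exact: integrable_AdA.
  rewrite -!RintegralZl//; last exact: integrableR_sum.
  rewrite -RintegralB//; last 2 first.
    apply: integrableRZ; exact: integrableR_sum.
    exact: integrableRZ.
  by apply: eq_Rintegral => s _; rewrite D_integrandE sum_AdA mulKf.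
rewrite -mulrBr; congr (_ * _).
have -> : \sum_(i < m) RI (AdA i) = \sum_(i < m)
  (RI (fun s => Aw theta w E s `^ (theta + 1)) -
   RI (fun s => (Aw theta w E s - w i * E i s `^ p) `^ (theta + 1))).
  by apply: eq_bigr => i _; rewrite (ibp i) addrC addKr.
rewrite sumrB sumr_const card_ord -[_ *+ m]mulr_natl; ring.
Qed.

End weights.
End moments.

Lemma ae_exists {R : realType} d (T : measurableType d) (Q : probability T R)
  (A : set T) : almost_everywhere Q A -> exists s, A s.
Proof.
move=> QA; have T0 : (0 < Q [set: T])%E by rewrite probability_setT.
have PF := ae_properfilter_algebraOfSetsType T0.
exact: filter_ex QA.
Qed.

(** * The Gamma function through exponential moments *)

Section gamma.
Context {R : realType} {m : nat} d (T : measurableType d) (Q : probability T R).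
Variable E : 'I_m -> {RV Q >-> R}.
Hypothesis E_iid : iid_exp1 E.
Variable theta : R.
Hypothesis theta0 : 0 < theta.
Let p := theta^-1.
Let p0 : 0 < p. Proof. by rewrite invr_gt0. Qed.
Local Notation leb := (@lebesgue_measure R).
Variable i : 'I_m.

Let exp_powE : (\int[Q]_s (E i s `^ p)%:E =
  \int[leb]_(x in `]0%R, +oo[) (x `^ p * expR (- x))%:E)%E.
Proof.
rewrite -(ge0_integral_law (E i) (f := fun x => (x `^ p)%:E)).
- rewrite (ge0_integral_exp_law (exp1_law E_iid i))//.
  + by apply/measurable_EFinP; exact: measurable_powR.
  + by move=> x; rewrite lee_fin powR_ge0.
- by apply/measurable_EFinP; exact: measurable_powR.
- by move=> x; rewrite lee_fin powR_ge0.
Qed.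

Lemma expectation_exp_powR : (\int[Q]_s (E i s `^ p)%:E = (Gamma (1 + p))%:E)%E.
Proof.
rewrite /Gamma /Rintegral addrAC subrr add0r -exp_powE fineK//.
rewrite ge0_fin_numE ?(exp1_moment E_iid)//.
by apply: integral_ge0 => s _; rewrite lee_fin powR_ge0.
Qed.

(** A vanishing moment would force E_i^p = 0 almost surely, although E_i > 0 almost surely. *)
Lemma Gamma_gt0 : 0 < Gamma (1 + p).
Proof.
have G0 : (0 <= (Gamma (1 + p))%:E)%E.
  rewrite -expectation_exp_powR; apply: integral_ge0 => s _.
  by rewrite lee_fin powR_ge0.
rewrite lt_neqAle -lee_fin G0 andbT; apply/negP => /eqP G00.
have : (\int[Q]_s `|(E i s `^ p)%:E| = 0)%E.
  under eq_integral do rewrite gee0_abs ?lee_fin ?powR_ge0//.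
  by rewrite expectation_exp_powR -G00.
have mE : measurable_fun setT (fun s => (E i s `^ p)%:E).
  by apply/measurable_EFinP; exact: measurable_exp_powR.
move/(ae_eq_integral_abs Q measurableT mE) => H.
have [s [/(_ I)/= [] /powR_eq0_eq0 s0 /(_ i)]] :=
  ae_exists (filterI H (ae_exp1_gt0 E_iid)).
by rewrite s0 ltxx.
Qed.

(** A change of variables done probabilistically: the integrand is the tail at z of (E_i / c)^p, and
    the integral of the tail of a nonnegative variable is its expectation. *)
Lemma integral_expR_powR (c : R) : 0 < c ->
  (\int[leb]_(z in `[0%R, +oo[) (expR (- (c * z `^ theta)))%:E =
   (c `^ (- p) * Gamma (1 + p))%:E)%E.
Proof.
move=> c0.
(* The maximum sends negative values to 0; the power of a negative base would not be 0 and would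
   spoil the equivalence with E_i > c z^theta. *)
pose f (x : R) := (Num.max x 0 / c) `^ p.
have mf : measurable_fun setT f.
  apply: (measurableT_comp (measurable_powR _)).
  by apply: measurable_funM => //; apply: measurable_maxr.
have mX : measurable_fun setT (f \o E i).
  exact: (measurableT_comp mf (measurable_funP (E i))).
pose X : {RV Q >-> R} := mfun_Sub (mem_set mX).
have X0 s : 0 <= X s by rewrite powR_ge0.
rewrite (_ : (\int[leb]_(z in _) _)%E = (\int[leb]_(z in `[0%R, +oo[) ccdf X z)%E).
  rewrite -(ge0_expectation_ccdf X0) unlock.
  rewrite -[LHS](ge0_integral_law (E i) (f := EFin \o f)); last 2 first.
  - exact/measurable_EFinP.
  - by move=> x; rewrite lee_fin powR_ge0.
  rewrite (ge0_integral_exp_law (exp1_law E_iid i)); last 2 first.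
  - exact/measurable_EFinP.
  - by move=> x; rewrite lee_fin powR_ge0.
  rewrite EFinM -expectation_exp_powR exp_powE -ge0_integralZl//; last 3 first.
  - apply/measurable_EFinP/measurable_funTS; apply: measurable_funM.
      exact: measurable_powR.
    by apply: measurableT_comp => //; exact: measurable_expR.
  - by move=> x _; rewrite lee_fin mulr_ge0 ?powR_ge0 ?expR_ge0.
  - by rewrite lee_fin powR_ge0.
  apply: eq_integral => x; rewrite inE/= in_itv/= andbT => x0.
  rewrite /f/= max_l ?ltW// powRM ?invr_ge0 ?(ltW c0) ?(ltW x0)//.
  rewrite -powR_inv1 ?(ltW c0)// -powRrM mulN1r.
  by rewrite -!EFinM; congr EFin; ring.
apply: eq_integral => z; rewrite inE/= in_itv/= andbT => z0.
rewrite /ccdf -(exp_law_occdf (exp1_law E_iid i)); last first.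
  by rewrite mulr_ge0 ?powR_ge0// ltW.
congr (Q _); apply/seteqP; split => s /=; rewrite !in_itv/= !andbT /f.
- move=> cE; have Es0 : 0 < E i s.
    by apply: le_lt_trans cE; rewrite mulr_ge0 ?powR_ge0// ltW.
  rewrite max_l ?ltW//; have -> : z = (z `^ theta) `^ p.
    by rewrite -powRrM mulfV ?gt_eqF// powRr1.
  apply: gt0_ltr_powR; rewrite ?nnegrE ?powR_ge0 ?divr_ge0 ?(ltW c0) ?(ltW Es0)//.
  by rewrite ltr_pdivlMr// mulrC.
- have [E0|E0] := leP (E i s) 0.
    by rewrite mul0r powR0 ?gt_eqF// ltNge z0.
  move=> zE; rewrite ltNge; apply/negP => cE.
  move: zE; rewrite ltNge => /negP; apply.
  have -> : z = (z `^ theta) `^ p.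
    by rewrite -powRrM mulfV ?gt_eqF// powRr1.
  apply: ge0_ler_powR; rewrite ?nnegrE ?powR_ge0 ?divr_ge0 ?(ltW c0) ?(ltW E0) ?(ltW p0)//.
  by rewrite ler_pdivrMr// mulrC.
Qed.

End gamma.

(** * Sign of the alternative integrand *)

Section superadditivity.
Context {R : realType} {m : nat}.
Variables (theta : R) (x : 'I_m -> R).
Hypotheses (theta0 : 0 < theta) (x0 : forall i, 0 <= x i).
Let S := \sum_(i < m) x i.

Let S0 : 0 <= S. Proof. exact: sumr_ge0. Qed.

(** Because the S - x_i add up to (m - 1) S, the superadditivity inequality reduces to comparing (S
    - x_i)^theta with S^theta term by term. *)
Let SD : (m%:R - 1) * S `^ (theta + 1) = \sum_(i < m) S `^ theta * (S - x i).
Proof.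
rewrite -mulr_sumr sumrB sumr_const card_ord -/S -[S *+ m]mulr_natl.
have [->|S1] := eqVneq S 0.
  by rewrite powR0 ?gt_eqF// ?addr_gt0// powR0 ?gt_eqF// mulr0 mul0r.
by rewrite powRD ?S1 ?implybT// powRr1//; ring.
Qed.

Let xS i : x i <= S.
Proof. by rewrite /S (bigD1 i)//= lerDl sumr_ge0. Qed.

Let termD i : (S - x i) `^ (theta + 1) = (S - x i) `^ theta * (S - x i).
Proof.
have [->|S1] := eqVneq (S - x i) 0.
  by rewrite mulr0 powR0 ?gt_eqF// addr_gt0.
by rewrite powRD ?S1 ?implybT// powRr1// subr_ge0.
Qed.

Let term_le i : (S - x i) `^ (theta + 1) <= S `^ theta * (S - x i).
Proof.
rewrite termD ler_wpM2r ?subr_ge0//.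
by apply: ge0_ler_powR; rewrite ?nnegrE ?subr_ge0 ?(ltW theta0)// gerBl.
Qed.

Lemma powR_sum_sub_le :
  \sum_(i < m) (S - x i) `^ (theta + 1) <= (m%:R - 1) * S `^ (theta + 1).
Proof. by rewrite SD; apply: ler_sum => i _; exact: term_le. Qed.

(** The term of index [j] is strict: x_j > 0 makes S - x_j smaller than S, and x_k > 0 keeps the
    common factor S - x_j positive. *)
Lemma powR_sum_sub_lt j k : j != k -> 0 < x j -> 0 < x k ->
  \sum_(i < m) (S - x i) `^ (theta + 1) < (m%:R - 1) * S `^ (theta + 1).
Proof.
move=> jk xj xk; rewrite SD (bigD1 j)//= [ltRHS](bigD1 j)//=.
apply: ltr_leD; last by apply: ler_sum => i _; exact: term_le.
have Sxj : 0 < S - x j.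
  rewrite /S (bigD1 j)//= addrC addrK (bigD1 k) 1?eq_sym//=.
  by rewrite ltr_pwDl// sumr_ge0.
rewrite termD ltr_pM2r//; apply: gt0_ltr_powR; rewrite ?nnegrE ?(ltW Sxj)//.
by rewrite gtrBl.
Qed.

End superadditivity.

(** * Positivity of the coefficient, and remaining moments *)

Section sign.
Context {R : realType} {m : nat} d (T : measurableType d) (Q : probability T R).
Variable E : 'I_m -> {RV Q >-> R}.
Hypothesis E_iid : iid_exp1 E.
Variables (theta : R) (w : 'I_m -> R).
Hypotheses (theta0 : 0 < theta) (w_simplex : simplex w).
Let p := theta^-1.
Let p0 : 0 < p. Proof. by rewrite invr_gt0. Qed.
Let w0 : forall i, 0 <= w i := w_simplex.1.

Let x0 s i : 0 <= w i * E i s `^ p.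
Proof. by rewrite mulr_ge0// powR_ge0. Qed.

Lemma D_integrand_alt_ge0 s : 0 <= D_integrand_alt theta w E s.
Proof. by rewrite subr_ge0; apply: powR_sum_sub_le. Qed.

(** A nonnegative integrand with zero expectation vanishes almost everywhere, but this one is
    positive wherever all [E i] are. *)
Lemma expectation_D_integrand_alt_gt0 : (2 <= #|[pred i | (0 < w i)%R]|)%N ->
  0 < fine 'E_Q[D_integrand_alt theta w E].
Proof.
move=> /card_gt1P[j [k [/=]]]; rewrite !inE => wj wk jk.
have iD := integrable_D_integrand_alt E_iid theta0 w0.
have mD := measurable_int _ iD.
rewrite unlock.
have D0 : (0 <= \int[Q]_s (D_integrand_alt theta w E s)%:E)%E.
  by apply: integral_ge0 => s _; rewrite lee_fin D_integrand_alt_ge0.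
rewrite fine_gt0// lt_neqAle D0 andbT; apply/andP; split; last first.
  by have := integrable_fin_num measurableT iD; rewrite ge0_fin_numE.
apply/negP => /eqP D00.
have : (\int[Q]_s `|(D_integrand_alt theta w E s)%:E| = 0)%E.
  by under eq_integral do rewrite gee0_abs ?lee_fin ?D_integrand_alt_ge0//.
move/(ae_eq_integral_abs Q measurableT mD) => H.
have [s [/(_ I)/= [] Ds s0]] := ae_exists (filterI H (ae_exp1_gt0 E_iid)).
have : 0 < D_integrand_alt theta w E s.
  rewrite subr_gt0; apply: (@powR_sum_sub_lt _ _ theta _ theta0 (x0 s) j k) => //.
  - by rewrite mulr_gt0// powR_gt0.
  - by rewrite mulr_gt0// powR_gt0.
by rewrite Ds ltxx.
Qed.

Lemma a_gt0 : 0 < a_ theta.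
Proof.
rewrite invr_gt0; have [i _] : exists i : 'I_m, true.
  case: (pickP 'I_m) => [i _|m0]; first by exists i.
  move: w_simplex.2; rewrite big_pred0//= => /esym/eqP.
  by rewrite oner_eq0.
exact: (Gamma_gt0 E_iid theta0 i).
Qed.

Lemma D_coefE : D_coef theta w E =
  a_ theta / (theta + 1) * fine 'E_Q[D_integrand_alt theta w E].
Proof. by rewrite /D_coef (expectation_D_integrand E_iid theta0 w0) mulrA. Qed.

Lemma D_coef_gt0 : (2 <= #|[pred i | (0 < w i)%R]|)%N -> 0 < D_coef theta w E.
Proof.
move=> w2; rewrite D_coefE mulr_gt0 ?divr_gt0 ?addr_gt0 ?a_gt0//.
exact: expectation_D_integrand_alt_gt0.
Qed.

(** The alternative integrand is identically zero: the active index contributes 0^(theta+1) = 0 and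
    each of the other m - 1 indices contributes Aw^(theta+1). *)
Lemma D_coef_eq0 : #|[pred i | w i != 0]| = 1%N -> D_coef theta w E = 0.
Proof.
move=> /eqP/card1P[k wk].
have w_k i : i != k -> w i = 0.
  by move=> ik; have := wk i; rewrite !inE (negbTE ik) => /negbFE/eqP.
rewrite D_coefE unlock integral0_eq ?mulr0// => s _; congr EFin.
have AE : Aw theta w E s = w k * E k s `^ theta^-1.
  by rewrite /Aw (bigD1 k)//= big1 ?addr0// => i /w_k ->; rewrite mul0r.
rewrite /D_integrand_alt (bigD1 k)//= AE subrr powR0 ?gt_eqF ?addr_gt0// add0r.
under eq_bigr => i /w_k -> do rewrite mul0r subr0.
rewrite sumr_const -[(_ `^ _) *+ _]mulr_natl -mulrBl.
have -> : #|[pred i | i != k]| = m.-1.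
  by rewrite (eq_card (B := predC1 k))// cardC1 card_ord.
by rewrite -subn1 natrB ?subrr ?mul0r// (leq_ltn_trans _ (ltn_ord k)).
Qed.

(** Together with the definition of [a_], this is why the leading term of the tail is exactly 1/t
    for all simplex weights. *)
Lemma expectation_Aw : (\int[Q]_s (Aw theta w E s)%:E = (Gamma (1 + p))%:E)%E.
Proof.
under eq_integral do rewrite /Aw -sumEFin.
rewrite ge0_integral_sum//; last 2 first.
- move=> i; apply/measurable_EFinP; apply: measurable_funM => //.
  exact: measurable_exp_powR.
- by move=> i s _; rewrite lee_fin.
under eq_bigr => i _.
  under eq_integral do rewrite EFinM.
  rewrite ge0_integralZl//; last 3 first.
  - by apply/measurable_EFinP; exact: measurable_exp_powR.
  - by move=> s _; rewrite lee_fin powR_ge0.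
  - by rewrite lee_fin.
  rewrite (expectation_exp_powR E_iid theta0 i) -EFinM.
  over.
by rewrite sumEFin -mulr_suml w_simplex.2 mul1r.
Qed.

Lemma simplex_le1 i : w i <= 1.
Proof. by rewrite -w_simplex.2 (bigD1 i)//= lerDl sumr_ge0. Qed.

(* [total <= m * (\sum_i E_i^p)^theta], and this sum is [Aw] for unit weights, so
   [integrable_AwBw] applies. *)
Lemma integrable_totalBw :
  Q.-integrable setT (EFin \o (fun s => total E s * Bw theta w E s)).
Proof.
pose u (_ : 'I_m) : R := 1.
have u0 i : 0 <= u i by rewrite /u.
apply: (@le_integrableR _ _ _ _ _
  (fun s => m%:R * (Aw theta u E s `^ theta * Bw theta u E s))).
- apply: measurable_funM; first exact: measurable_total.
  exact: measurable_Bw.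
- move=> s; have B0 : 0 <= Bw theta w E s by exact: Bw_ge0.
  rewrite ger0_norm; last by rewrite mulr_ge0// total_ge0.
  rewrite mulrA ler_pM ?total_ge0//; last first.
    rewrite /Bw ler_wpM2l ?(ltW p0)//; apply: ler_sum => i _.
    by rewrite ler_wpM2r ?powR_ge0// simplex_le1.
  have -> : m%:R * Aw theta u E s `^ theta = \sum_(i < m) Aw theta u E s `^ theta.
    by rewrite sumr_const card_ord mulr_natl.
  apply: ler_sum => i _.
  rewrite (_ : E i s `^ 1 = (E i s `^ p) `^ theta); last first.
    by rewrite -powRrM mulVf// gt_eqF.
  apply: ge0_ler_powR; rewrite ?nnegrE ?powR_ge0 ?(ltW theta0) ?Aw_ge0//.
  rewrite /Aw (bigD1 i)//= mul1r lerDl sumr_ge0// => j _.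
  by rewrite mulr_ge0// powR_ge0.
- by apply/integrableRZ; exact: (integrable_AwBw E_iid theta0 u0).
Qed.

End sign.

(** * Expansion given the exponential variables *)

Section gamma_incomplete.
Context {R : realType}.
Local Notation leb := (@lebesgue_measure R).
Variable theta : R.
Hypothesis theta0 : 0 < theta.

Lemma integral_powR (q z : R) : 0 < q -> 0 < z ->
  (\int[leb]_(x in `]0%R, z]) (x `^ q)%:E = (z `^ (q + 1) / (q + 1))%:E)%E.
Proof.
move=> q0 z0; have q1 : 0 < q + 1 by rewrite addr_gt0.
pose F (x : R) := (q + 1)^-1 * x `^ (q + 1).
have cvgF : F x @[x --> 0^'+] --> F 0.
  rewrite /F powR0 ?gt_eqF// mulr0 -[X in _ --> X](mulr0 (q + 1)^-1).
  by apply: cvgM; [exact: cvg_cst|exact: powR_cvg0].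
have dF (x : R) : 0 < x -> is_derive x (1 : R) F (x `^ q).
  move=> x0; have dx := is_derive1_powR (q + 1) x0.
  by apply: is_derive_eq; rewrite /GRing.scale/= addrK mulKf// gt_eqF.
have cf (x : R) : 0 < x -> {for x, continuous (fun y : R => y `^ q)}.
  exact: continuous_powR_gt0.
rewrite (ge0_FTC2_open (fun x _ => powR_ge0 x q) cvgF dF cf z0) -EFinB.
by rewrite /F powR0 ?gt_eqF// mulr0 subr0 mulrC.
Qed.

(* Up to a factor, the distribution function of [V `^ (1 / theta)], where [V] is
   gamma distributed with shape [1 / theta]. *)
Definition gamma_cdf (z : R) : R := \int[leb]_(x in `]0, z]) expR (- x `^ theta).

Lemma measurable_expR_powR : measurable_fun setT (fun x : R => expR (- x `^ theta)).
Proof.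
apply: measurableT_comp => //; apply: measurable_funN.
exact: measurable_powR.
Qed.

Let mE D : measurable_fun D (fun x : measurableTypeR R => (expR (- x `^ theta))%:E).
Proof. by apply/measurable_EFinP/measurable_funTS; exact: measurable_expR_powR. Qed.

Let mP D q : measurable_fun D (fun x : measurableTypeR R => (x `^ q)%:E).
Proof. by apply/measurable_EFinP/measurable_funTS; exact: measurable_powR. Qed.

Let int1 (z : R) : 0 < z -> (\int[leb]_(x in `]0%R, z]) 1%:E = z%:E)%E.
Proof.
move=> z0; rewrite integral_cst//= mul1e lebesgue_measure_itv/= lte_fin z0.
by rewrite sube0.
Qed.

Lemma gamma_cdfE (z : R) : 0 < z ->
  (\int[leb]_(x in `]0%R, z]) (expR (- x `^ theta))%:E = (gamma_cdf z)%:E)%E.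
Proof.
move=> z0; rewrite /gamma_cdf /Rintegral fineK// ge0_fin_numE; last first.
  by apply: integral_ge0 => x _; rewrite lee_fin expR_ge0.
apply: (@le_lt_trans _ _ z%:E); last exact: ltry.
rewrite -(int1 z0); apply: ge0_le_integral => //.
by move=> x _; rewrite lee_fin -expR0 ler_expR oppr_le0 powR_ge0.
Qed.

Lemma gamma_cdf_le (z : R) : 0 < z -> gamma_cdf z <= z.
Proof.
move=> z0; rewrite -lee_fin -gamma_cdfE// -int1//; apply: ge0_le_integral => //.
by move=> x _; rewrite lee_fin -expR0 ler_expR oppr_le0 powR_ge0.
Qed.

(** Negative terms of the two bounds below are moved across the inequality, so that only nonnegative
    integrands are compared. *)
Let gamma_cdfD (z q : R) : 0 < z -> 0 < q ->
  (\int[leb]_(x in `]0%R, z]) ((expR (- x `^ theta))%:E + (x `^ q)%:E) =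
  (gamma_cdf z + z `^ (q + 1) / (q + 1))%:E)%E.
Proof.
move=> z0 q0; rewrite ge0_integralD//; last first.
  by move=> x _; rewrite lee_fin powR_ge0.
by rewrite gamma_cdfE// integral_powR// EFinD.
Qed.

Lemma gamma_cdf_lower (z : R) : 0 < z ->
  z - z `^ (theta + 1) / (theta + 1) <= gamma_cdf z.
Proof.
move=> z0; rewrite lerBlDr -lee_fin -gamma_cdfD// -{1}(int1 z0).
apply: ge0_le_integral => //.
- by apply: emeasurable_funD.
- move=> x _; rewrite -EFinD lee_fin.
  by have := expR_ge1Dx (- x `^ theta); lra.
Qed.

(** Integrates e^(-u) <= 1/(1+u) <= 1 - u + u^2 at u = x^theta; the factor 1/(2 theta + 1) of the
    last term is bounded by 1. *)
Lemma gamma_cdf_upper (z : R) : 0 < z ->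
  gamma_cdf z <= z - z `^ (theta + 1) / (theta + 1) + z `^ (theta *+ 2 + 1).
Proof.
move=> z0; have t20 : 0 < theta *+ 2 by rewrite pmulrn_lgt0.
suff : gamma_cdf z + z `^ (theta + 1) / (theta + 1) <=
       z + z `^ (theta *+ 2 + 1) / (theta *+ 2 + 1).
  have : z `^ (theta *+ 2 + 1) / (theta *+ 2 + 1) <= z `^ (theta *+ 2 + 1).
    rewrite ler_pdivrMr ?addr_gt0// ler_peMr ?powR_ge0//.
    by rewrite lerDr ltW.
  lra.
rewrite -lee_fin -gamma_cdfD// (EFinD z) -(int1 z0) -integral_powR//.
rewrite -ge0_integralD//; last by move=> x _; rewrite lee_fin powR_ge0.
apply: ge0_le_integral => //.
- by move=> x _; rewrite -EFinD lee_fin addr_ge0 ?expR_ge0 ?powR_ge0.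
- by apply: emeasurable_funD.
- by apply: emeasurable_funD.
- move=> x _; rewrite -!EFinD lee_fin.
  have -> : x `^ (theta *+ 2) = (x `^ theta) ^+ 2.
    by rewrite -powR_mulrn ?powR_ge0// -powRrM mulr_natr.
  have u0 := powR_ge0 x theta; move: (x `^ theta) u0 => u u0.
  have u1 : 0 < 1 + u by rewrite ltr_pwDl.
  have : expR (- u) <= (1 + u)^-1.
    by rewrite expRN lef_pV2 ?posrE ?expR_gt0// expR_ge1Dx.
  have : (1 + u)^-1 <= 1 - u + u ^+ 2.
    rewrite -[leLHS]mul1r ler_pdivrMr// -subr_ge0.
    have -> : (1 - u + u ^+ 2) * (1 + u) - 1 = u ^+ 3 by ring.
    exact: exprn_ge0.
  lra.
Qed.

(** Normalised second-order term of [gamma_cdf] at 0: uniformly bounded, as domination requires, and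
    tending to [b_ theta]. *)
Definition gamma_gap (z : R) : R := (z - gamma_cdf z) / z `^ (theta + 1).

Lemma gamma_gap_ge0 z : 0 < z -> 0 <= gamma_gap z.
Proof. by move=> z0; rewrite divr_ge0 ?powR_ge0// subr_ge0 gamma_cdf_le. Qed.

Lemma gamma_gap_ub z : 0 < z -> gamma_gap z <= (theta + 1)^-1.
Proof.
move=> z0; rewrite ler_pdivrMr ?powR_gt0//.
by have := gamma_cdf_lower z0; rewrite mulrC; lra.
Qed.

Lemma gamma_gap_lb z : 0 < z -> (theta + 1)^-1 - z `^ theta <= gamma_gap z.
Proof.
move=> z0; rewrite ler_pdivlMr ?powR_gt0// mulrBl -powRD; last first.
  by rewrite (gt_eqF z0) implybT.
have := gamma_cdf_upper z0.
rewrite (_ : theta + (theta + 1) = theta *+ 2 + 1); last by rewrite addrA -mulr2n.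
rewrite [_ / (theta + 1)]mulrC; lra.
Qed.

Lemma cvg_gamma_gap : gamma_gap z @[z --> 0^'+] --> (theta + 1)^-1.
Proof.
apply: (@squeeze_cvgr _ _ _ _ (fun z => (theta + 1)^-1 - z `^ theta)
  (fun=> (theta + 1)^-1)); last 2 first.
- rewrite -[X in _ --> X]subr0; apply: cvgB; first exact: cvg_cst.
  exact: powR_cvg0.
- exact: cvg_cst.
near=> z; have z0 : 0 < z by near: z; exact: nbhs_right_gt.
by rewrite gamma_gap_lb// gamma_gap_ub.
Unshelve. all: by end_near. Qed.

End gamma_incomplete.

(** * The crossing point for fixed values of the exponential variables *)

Section crossing.
Context {R : realType} {m : nat}.
Local Notation leb := (@lebesgue_measure R).
Variables (theta : R) (w e : 'I_m -> R).
Hypotheses (theta0 : 0 < theta) (w_simplex : simplex w).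
Hypothesis e0 : forall i, 0 < e i.
Let p := theta^-1.
Let p0 : 0 < p. Proof. by rewrite invr_gt0. Qed.
Let w0 : forall i, 0 <= w i := w_simplex.1.
Let thp : theta * p = 1. Proof. by rewrite mulfV// gt_eqF. Qed.

Definition phi (v : R) : R := \sum_(i < m) w i * (v + e i) `^ p.
Let M := \sum_(i < m) e i.
Let B := p * \sum_(i < m) w i * e i `^ (p - 1).

Let pos_weight : exists i, 0 < w i.
Proof.
apply: contrapT => H; have : \sum_(i < m) w i <= 0.
  by apply: sumr_le0 => i _; rewrite leNgt; apply/negP => wi; apply: H; exists i.
by rewrite w_simplex.2 ler10.
Qed.

Let e_le i : e i <= M.
Proof. by rewrite /M (bigD1 i)//= lerDl sumr_ge0// => j _; exact: ltW. Qed.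

Let M0 : 0 < M.
Proof. by have [i _] := pos_weight; exact: lt_le_trans (e_le i). Qed.

Lemma phi_gt0 v : 0 <= v -> 0 < phi v.
Proof.
move=> v0; have [i wi] := pos_weight.
rewrite /phi (bigD1 i)//= ltr_pwDl ?mulr_gt0 ?powR_gt0 ?ltr_wpDl//.
by apply: sumr_ge0 => j _; rewrite mulr_ge0// powR_ge0.
Qed.

Lemma phi_scale v c : 0 < v -> 0 <= c -> (forall i, v + e i <= c * v) ->
  phi v <= c `^ p * v `^ p.
Proof.
move=> v0 c0 ec; rewrite -[leRHS]mul1r -w_simplex.2 mulr_suml; apply: ler_sum => i _.
rewrite ler_wpM2l// -powRM ?(ltW v0)//; apply: ge0_ler_powR => //.
- exact: ltW.
- by rewrite nnegrE addr_ge0 ?ltW.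
- by rewrite nnegrE mulr_ge0 ?(ltW v0).
Qed.

Let cvg_phi_term i (U : Type) (F : set_system U) (FF : Filter F) (f : U -> R) (l : R) :
  0 <= l -> (\forall u \near F, 0 <= f u) -> f u @[u --> F] --> l ->
  (f u + e i) `^ p @[u --> F] --> (l + e i) `^ p.
Proof.
move=> l0 f0 fl; apply: cvg_powR => //.
- by apply: filterS f0 => u fu; rewrite addr_ge0 ?(ltW (e0 i)).
- by rewrite addr_ge0 ?(ltW (e0 i)).
- by apply: cvgD => //; exact: cvg_cst.
Qed.

Lemma cvg_phi (U : Type) (F : set_system U) (FF : Filter F) (f : U -> R) (l : R) :
  0 <= l -> (\forall u \near F, 0 <= f u) -> f u @[u --> F] --> l ->
  phi (f u) @[u --> F] --> phi l.
Proof.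
move=> l0 f0 fl; apply: cvg_big => [|i _]; first exact: add_continuous.
by apply: cvgM; [exact: cvg_cst|exact: cvg_phi_term].
Qed.

Let weighted_sum_lt (a b : 'I_m -> R) : (forall i, a i < b i) ->
  \sum_(i < m) w i * a i < \sum_(i < m) w i * b i.
Proof.
move=> ab; have [k wk] := pos_weight.
rewrite (bigD1 k)//= [ltRHS](bigD1 k)//=; apply: ltr_leD.
  by rewrite ltr_pM2l.
by apply: ler_sum => i _; rewrite ler_wpM2l// ltW.
Qed.

Let scale_in (a b c : R) : 0 < a -> 0 < b -> 0 < c ->
  (b + c) `^ p * a = (a `^ theta * b + a `^ theta * c) `^ p.
Proof.
move=> a0 b0 c0; rewrite -mulrDr powRM ?powR_ge0 ?addr_ge0 ?(ltW b0) ?(ltW c0)//.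
by rewrite -powRrM thp powRr1 1?mulrC// ltW.
Qed.

(** [X] and [Y] stand for x^theta and y^theta. Both products become p-th powers sharing the part X
    Y, which leaves X c < Y c to compare. *)
Let phi_div_decreasing_aux (x y X Y : R) : 0 < X -> X < Y ->
  (forall c, 0 < c -> (Y + c) `^ p * x = (X * Y + X * c) `^ p) ->
  (forall c, 0 < c -> (X + c) `^ p * y = (Y * X + Y * c) `^ p) ->
  phi Y * x < phi X * y.
Proof.
move=> X0 XY xE yE; have Y0 := lt_trans X0 XY.
have phiM v c : phi v * c = \sum_(i < m) w i * ((v + e i) `^ p * c).
  by rewrite /phi mulr_suml; apply: eq_bigr => i _; rewrite mulrA.
rewrite (phiM Y x) (phiM X y); apply: weighted_sum_lt => i.
rewrite (xE _ (e0 i)) (yE _ (e0 i)) [Y * X]mulrC; apply: gt0_ltr_powR => //.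
- by rewrite nnegrE addr_ge0// mulr_ge0 ?ltW.
- by rewrite nnegrE addr_ge0// mulr_ge0 ?ltW.
- by rewrite ltrD2l ltr_pM2r.
Qed.

(** The map z -> phi(z^theta)/z is strictly decreasing, being a weighted sum of (1 + e_i/z^theta)^p.
    It makes the crossing unique and the event an interval. *)
Lemma phi_div_decreasing (x y : R) : 0 < x -> x < y ->
  phi (y `^ theta) * x < phi (x `^ theta) * y.
Proof.
move=> x0 xy; have y0 := lt_trans x0 xy; apply: phi_div_decreasing_aux.
- exact: powR_gt0.
- by apply: gt0_ltr_powR; rewrite ?nnegrE ?ltW.
- by move=> c; apply: scale_in => //; exact: powR_gt0.
- by move=> c; apply: scale_in => //; exact: powR_gt0.
Qed.

Section root.
Variable t : R.
Hypotheses (t0 : 0 < t) (t2 : 2 <= t `^ theta).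

Lemma crossing_exists : exists2 z : R, 0 < z & t * z = phi (z `^ theta).
Proof.
(* [v1] solves v + M = t^theta v, so v1 + e_i <= t^theta v1 for every [i]: at this point the line
   has already overtaken [phi]. *)
pose v1 := M / (t `^ theta - 1).
have tt1 : 0 < t `^ theta - 1 by rewrite subr_gt0 (lt_le_trans _ t2)// ltr1n.
have v10 : 0 < v1 by rewrite divr_gt0.
pose z1 := v1 `^ p; have z10 : 0 < z1 by exact: powR_gt0.
have z1v : z1 `^ theta = v1 by rewrite -powRrM mulrC thp powRr1// ltW.
pose h z := t * z - phi (z `^ theta).
have ch : {within `[0, z1], continuous h}.
  apply/continuous_within_itvP => //; split.
  - move=> x; rewrite in_itv/= => /andP[x0 _].
    rewrite /continuous_at /h; apply: cvgB.
      by apply: cvgM; [exact: cvg_cst|exact: cvg_id].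
    apply: cvg_phi; first exact: powR_ge0.
      by apply: nearW => ?; exact: powR_ge0.
    exact: continuous_powR_gt0.
  - rewrite /h; apply: cvgB.
      apply: cvgM; first exact: cvg_cst.
      exact: cvg_at_right_filter cvg_id.
    apply: cvg_phi; first exact: powR_ge0.
      by apply: nearW => ?; exact: powR_ge0.
    by rewrite powR0 ?gt_eqF//; exact: powR_cvg0.
  - rewrite /h; apply: cvgB.
      apply: cvgM; first exact: cvg_cst.
      exact: cvg_at_left_filter cvg_id.
    apply: cvg_phi; first exact: powR_ge0.
      by apply: nearW => ?; exact: powR_ge0.
    by apply: cvg_at_left_filter; exact: continuous_powR_gt0.
have h0 : h 0 < 0.
  by rewrite /h mulr0 powR0 ?gt_eqF// sub0r oppr_lt0 phi_gt0.
have h1 : 0 <= h z1.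
  rewrite /h z1v subr_ge0; have -> : t * z1 = (t `^ theta) `^ p * v1 `^ p.
    by rewrite -powRrM thp powRr1// ltW.
  apply: phi_scale => //; first exact: powR_ge0.
  move=> i; apply: (@le_trans _ _ (v1 + M)); first by rewrite lerD2l.
  have -> : M = v1 * (t `^ theta - 1) by rewrite /v1 divfK// gt_eqF.
  by rewrite mulrBr mulr1 addrC subrK mulrC.
have minmax (a b : R) : a < 0 -> 0 <= b -> Num.min a b <= 0 <= Num.max a b.
  by move=> a0 b0; rewrite ge_min le_max b0 (ltW a0) orbT.
have [z] := @IVT R h 0 z1 0 (ltW z10) ch (minmax _ _ h0 h1).
rewrite in_itv/= => /andP[z_ge0 _] hz; exists z; last first.
  by apply/eqP; rewrite -subr_eq0 -/(h z) hz.
rewrite lt_neqAle z_ge0 andbT; apply/negP => /eqP zE.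
by move: hz; rewrite -zE => h00; move: h0; rewrite h00 ltxx.
Qed.

Variable z : R.
Hypotheses (z0 : 0 < z) (zE : t * z = phi (z `^ theta)).

Lemma crossingP (x : R) : 0 < x -> (t * x < phi (x `^ theta)) = (x < z).
Proof.
move=> x0; apply/idP/idP => [tx|xz]; last first.
  have := phi_div_decreasing x0 xz; rewrite -zE => H.
  by rewrite -(ltr_pM2r z0); apply: le_lt_trans H; lra.
rewrite ltNge; apply/negP; rewrite le_eqVlt => /predU1P[zx|zx].
  by move: tx; rewrite -zx zE ltxx.
have := phi_div_decreasing z0 zx; rewrite -zE => H.
by move: tx; rewrite -(ltr_pM2r z0) => tx; lra.
Qed.

Let v := z `^ theta.
Let v0 : 0 < v. Proof. exact: powR_gt0. Qed.

Lemma crossing_powR : (t * z) `^ theta = t `^ theta * v.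
Proof. by rewrite powRM// ltW. Qed.

(* For [v > M / (t^theta - 1)] the curve [phi v] already lies below [t * v^(1/theta)]. *)
Lemma crossing_le : t `^ theta * v <= M *+ 2.
Proof.
suff : v * (t `^ theta - 1) <= M.
  move=> H; have : v * t `^ theta <= v * (t `^ theta - 1) *+ 2.
    rewrite -mulrnAr ler_pM2l//; have := t2; lra.
  by rewrite mulrC => /le_trans; apply; rewrite lerMn2r/=.
rewrite leNgt; apply/negP => Mv.
have [i wi] := pos_weight.
have : phi v < (t `^ theta) `^ p * v `^ p.
  rewrite -[ltRHS]mul1r -w_simplex.2 mulr_suml /phi.
  have lt_term j : (v + e j) `^ p < (t `^ theta) `^ p * v `^ p.
    rewrite -powRM ?powR_ge0//; apply: gt0_ltr_powR => //.
    - by rewrite nnegrE addr_ge0 ?ltW.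
    - by rewrite nnegrE mulr_ge0 ?powR_ge0.
    - by have := e_le j; lra.
  exact: weighted_sum_lt.
rewrite -powRrM thp powRr1 ?(ltW t0)// -powRrM thp powRr1 ?(ltW z0)//.
by rewrite -zE ltxx.
Qed.

Let v_leM : v <= M.
Proof.
have := crossing_le; have := M0.
have : v * 2 <= v * t `^ theta by rewrite ler_pM2l.
lra.
Qed.

Lemma phi_quotient_ge0 (x : R) : 0 < x -> 0 <= (phi x - phi 0) / x.
Proof.
move=> x0; rewrite divr_ge0 ?(ltW x0)// subr_ge0; apply: ler_sum => i _.
rewrite ler_wpM2l//; apply: ge0_ler_powR; rewrite ?nnegrE ?add0r ?addr_ge0 ?ltW//.
by rewrite ltrDr.
Qed.

(** By the mean value theorem each quotient is p c^(p-1) with e_i < c < e_i + v <= 2M. For p < 1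
    this is largest at e_i, for p >= 1 at 2M; adding the two bounds covers both cases. *)
Lemma phi_quotient_le : (phi v - phi 0) / v <= B + p * (M *+ 2) `^ (p - 1).
Proof.
rewrite ler_pdivrMr//.
have -> : B + p * (M *+ 2) `^ (p - 1) =
  \sum_(i < m) w i * (p * (e i `^ (p - 1) + (M *+ 2) `^ (p - 1))).
  rewrite /B mulr_sumr -[X in _ + X]mul1r -w_simplex.2 mulr_suml -big_split/=.
  by apply: eq_bigr => i _; ring.
rewrite /phi -sumrB mulr_suml; apply: ler_sum => i _.
rewrite -mulrBr -mulrA ler_wpM2l// add0r.
have [|||c] := @MVT R (fun x => x `^ p) (fun x => p * x `^ (p - 1)) (e i) (v + e i).
- by rewrite ltrDr.
- move=> x; rewrite in_itv/= => /andP[ex _].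
  by apply: is_derive1_powR; exact: lt_trans ex.
- apply: continuous_in_subspaceT => x; rewrite inE/= in_itv/= => /andP[ex _].
  by apply: continuous_powR_gt0; exact: lt_le_trans ex.
rewrite in_itv/= addrK => /andP[ec cv] ->.
rewrite ler_pM2r// ler_pM2l//.
have c0 : 0 < c by exact: lt_trans ec.
have [p1|p1] := leP 1 p.
  apply: (@le_trans _ _ ((M *+ 2) `^ (p - 1))); last by rewrite lerDr powR_ge0.
  apply: ge0_ler_powR; rewrite ?nnegrE ?subr_ge0 ?(ltW c0) ?mulrn_wge0 ?(ltW M0)//.
  by have := e_le i; have := v_leM; lra.
apply: (@le_trans _ _ (e i `^ (p - 1))); last by rewrite lerDl powR_ge0.
have -> : p - 1 = - (1 - p) by ring.
rewrite !powRN lef_pV2 ?posrE ?powR_gt0//.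
by apply: ge0_ler_powR; rewrite ?nnegrE ?subr_ge0 ?(ltW c0) ?(ltW ec) ?(ltW p1) ?(ltW (e0 i)).
Qed.

(** The scaled error with [t] eliminated through t z = phi v, v = z^theta, so that the limit t ->
    +oo becomes a right limit at v = 0. *)
Definition remainder (x : R) : R :=
  phi x `^ theta * ((phi x - phi 0) / x)
  - phi x `^ (theta + 1) * gamma_gap theta (x `^ p).

Let vp : v `^ p = z. Proof. by rewrite -powRrM thp powRr1// ltW. Qed.

(** Write G(z) = z - gap z^(theta+1). Then z - phi(0)/t = (phi v - phi 0)/t, t^theta = (phi v)^theta
    / v and (t z)^(theta+1) = (phi v)^(theta+1). *)
Lemma remainderE :
  t `^ (1 + theta) * (gamma_cdf theta z - phi 0 / t) = remainder v.
Proof.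
have tn0 : t != 0 by rewrite gt_eqF.
have vn0 : v != 0 by rewrite gt_eqF.
rewrite /remainder vp -zE crossing_powR /gamma_gap.
rewrite [(t * z) `^ (theta + 1)]powRM ?(ltW t0) ?(ltW z0)//.
have zn0 : z `^ (theta + 1) != 0 by rewrite gt_eqF// powR_gt0.
have -> : t `^ (1 + theta) = t * t `^ theta.
  by rewrite powRD ?tn0 ?implybT// powRr1// ltW.
have -> : t `^ (theta + 1) = t * t `^ theta.
  by rewrite powRD ?tn0 ?implybT// powRr1 1?mulrC// ltW.
by field; rewrite zn0 vn0 tn0.
Qed.

(** The bound is free of [t]. Each 2M comes from [crossing_le] or [phi_quotient_le]; in the former
    the 2 reflects t^theta <= 2 (t^theta - 1), that is t^theta >= 2. *)
Lemma remainder_bound : `|remainder v| <=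
  M *+ 2 * (B + p * (M *+ 2) `^ (p - 1)) + (M *+ 2) `^ (1 + p).
Proof.
have M20 : 0 <= M *+ 2 by rewrite mulrn_wge0// ltW.
have phi_pow : phi v `^ theta <= M *+ 2.
  by rewrite -zE crossing_powR crossing_le.
have q0 := phi_quotient_ge0 v0.
rewrite (le_trans (ler_normB _ _))// lerD//.
  rewrite ger0_norm; last exact: mulr_ge0 (powR_ge0 _ _) q0.
  exact: ler_pM (powR_ge0 _ _) q0 phi_pow phi_quotient_le.
rewrite vp ger0_norm; last exact: mulr_ge0 (powR_ge0 _ _) (gamma_gap_ge0 _ z0).
apply: (@le_trans _ _ (phi v `^ (theta + 1) * 1)).
  rewrite ler_wpM2l ?powR_ge0// (le_trans (gamma_gap_ub _ _))//.
  by rewrite invf_le1 ?addr_gt0// lerDr ltW.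
rewrite mulr1 (_ : theta + 1 = theta * (1 + p)); last by rewrite mulrDr thp mulr1.
rewrite powRrM; apply: ge0_ler_powR; rewrite ?nnegrE ?powR_ge0//.
by rewrite addr_ge0// ltW.
Qed.

End root.

Lemma cvg_remainder : remainder v @[v --> 0^'+] -->
  phi 0 `^ theta * B - phi 0 `^ (theta + 1) * (theta + 1)^-1.
Proof.
have near0 : \forall x \near (0 : R)^'+, 0 < x by exact: nbhs_right_gt.
have near_ge0 : \forall x \near (0 : R)^'+, 0 <= x by apply: filterS near0 => x /ltW.
have cp : phi x @[x --> 0^'+] --> phi 0.
  by apply: cvg_phi => //; exact: cvg_at_right_filter cvg_id.
have nearphi : \forall x \near (0 : R)^'+, 0 <= phi x.
  by apply: filterS near_ge0 => x /phi_gt0/ltW.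
have phi0 : 0 <= phi 0 by rewrite ltW// phi_gt0.
apply: cvgB; apply: cvgM.
- exact: cvg_powR.
- have dphi : is_derive (0 : R) (1 : R) phi B.
    have -> : B = \sum_(i < m) w i * (p * (0 + e i) `^ (p - 1)).
      by rewrite /B mulr_sumr; apply: eq_bigr => i _; rewrite add0r; ring.
    have di i : is_derive (0 : R) (1 : R) (fun v : R => w i * (v + e i) `^ p)
        (w i * (p * (0 + e i) `^ (p - 1))).
      have ei : 0 < 0 + e i by rewrite add0r.
      have de := is_derive1_powR p ei.
      have da : is_derive (0 : R) (1 : R) (fun v : R => v + e i) 1.
        by apply: is_derive_eq; rewrite addr0.
      have := @is_derive1_comp R (fun y => y `^ p) (fun v => v + e i) 0 _ _ de da.
      rewrite mulr1 => dc.
      by apply: is_derive_eq; rewrite /GRing.scale/= ?mulr0 ?addr0.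
    have := @is_derive_sum _ _ _ m (fun i v => w i * (v + e i) `^ p) 0 1 _ di.
    by rewrite (_ : \sum_(i < m) _ = phi)//; apply/funext => x; rewrite fct_sumE.
  have /cvg_dnbhs_at_right : (fun h : R => h^-1 *: ((phi \o shift 0) (h *: 1) - phi 0))
      @ 0^' --> B.
    by rewrite -(derive_val (is_derive := dphi)); exact: ex_derive.
  apply: cvg_trans; apply: near_eq_cvg; near=> x.
  by rewrite /= /GRing.scale/= mulr1 addr0 mulrC.
- by apply: cvg_powR => //; rewrite addr_gt0.
(* The limit of [gamma_gap] is one-sided, so x^p must be shown to tend to 0 through positive
   values. *)
- apply: (@cvg_comp _ _ _ (fun x => x `^ p) (gamma_gap theta) _ 0^'+); last exact: cvg_gamma_gap.
  move=> U [eps /= eps0 Ueps]; near=> x.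
  have x0 : 0 < x by near: x.
  apply: Ueps; last exact: powR_gt0.
  rewrite /= sub0r normrN gtr0_norm ?powR_gt0//.
  near: x; have := cvgr_lt 0 (powR_cvg0 p0) eps eps0.
  by apply.
Unshelve. all: by end_near. Qed.

End crossing.

(** * The Marshall-Olkin model *)

(** Squaring makes the base nonnegative, where the power -1 is the inverse; the extra factor x also
    gives the right value 0 at x = 0. *)
Lemma measurable_invr {R : realType} : measurable_fun setT (fun x : R => x^-1).
Proof.
have -> : (fun x : R => x^-1) = (fun x => x * (x ^+ 2) `^ (- 1)).
  apply/funext => x; rewrite powR_inv1 ?sqr_ge0//.
  have [->|x0] := eqVneq x 0; first by rewrite invr0 mul0r.
  by rewrite expr2 invfM mulrA mulfV// mul1r.
apply: measurable_funM => //.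
by apply: (measurableT_comp (measurable_powR (- 1))); exact: measurable_funX.
Qed.

(** * The law of the mixing variable *)

Section mixing_law.
Context {R : realType} (theta : R).
Hypothesis theta0 : 0 < theta.
Hypothesis Gamma0 : 0 < Gamma (1 + theta^-1) :> R.
Hypothesis expR_powR_integral : forall c : R, 0 < c ->
  (\int[lebesgue_measure]_(z in `[0%R, +oo[) (expR (- (c * z `^ theta)))%:E =
   (c `^ (- theta^-1) * Gamma (1 + theta^-1))%:E)%E.
Local Notation leb := (@lebesgue_measure R).
Let p := theta^-1.

Definition mixing_pdf : measurableTypeR R -> R :=
  (fun z => a_ theta * expR (- z `^ theta)) \_ `]0, +oo[.

Let a0 : 0 < a_ theta. Proof. by rewrite invr_gt0. Qed.

Let mpdf0 : measurable_fun setT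
  (fun z : measurableTypeR R => a_ theta * expR (- z `^ theta)).
Proof.
apply: measurable_funM => //.
apply: measurableT_comp; first exact: measurable_expR.
by apply: measurable_funN; exact: measurable_powR.
Qed.

Lemma measurable_mixing_pdf : measurable_fun setT mixing_pdf.
Proof.
apply/(measurable_restrictT _ _).1; first exact: measurable_itv.
exact: measurable_funTS.
Qed.

Lemma mixing_pdf_ge0 z : 0 <= mixing_pdf z.
Proof. by apply: restrict_ge0 => x _; rewrite mulr_ge0 ?expR_ge0 ?ltW. Qed.

Lemma integral_mixing_pdf (f : measurableTypeR R -> \bar R) :
  (\int[leb]_z (f z * (mixing_pdf z)%:E) =
   \int[leb]_(z in `]0%R, +oo[) (f z * (a_ theta * expR (- z `^ theta))%:E))%E.
Proof.
rewrite [RHS]integral_mkcond; apply: eq_integral => z _.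
by rewrite /mixing_pdf !patchE; case: ifPn => // _; rewrite mule0.
Qed.

(** The exponentials merge into one of rate 1 + c, and [a_ theta] cancels the Gamma factor. The case
    c = 0 is the total mass. *)
Let laplace_leb (c : R) : 0 <= c ->
  (\int[leb]_z ((expR (- (c * z `^ theta)))%:E * (mixing_pdf z)%:E) =
   ((1 + c) `^ (- p))%:E)%E.
Proof.
move=> c0; rewrite integral_mixing_pdf.
have c1 : 0 < 1 + c by rewrite ltr_pwDl.
transitivity (\int[leb]_(z in `]0%R, +oo[)
   ((a_ theta)%:E * (expR (- ((1 + c) * z `^ theta)))%:E))%E.
  apply: eq_integral => z _; rewrite -!EFinM; congr EFin.
  rewrite mulrCA; congr (_ * _); rewrite -expRD; congr expR; ring.
have me : measurable_fun setT
    (fun z : measurableTypeR R => (expR (- ((1 + c) * z `^ theta)))%:E).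
  apply/measurable_EFinP; apply: measurableT_comp; first exact: measurable_expR.
  apply: measurable_funN; apply: measurable_funM => //.
rewrite ge0_integralZl//; last 2 first.
- exact: measurable_funTS.
- by rewrite lee_fin ltW.
rewrite integral_itv_obnd_cbnd; last exact: measurable_funTS.
rewrite expR_powR_integral// -EFinM; congr EFin.
by rewrite /a_ mulrCA mulVf ?gt_eqF// mulr1.
Qed.

Lemma mixing_pdf_integral1 : (\int[leb]_z (mixing_pdf z)%:E = 1)%E.
Proof.
have := laplace_leb (lexx 0); rewrite addr0 powR1 => <-.
by apply: eq_integral => z _; rewrite mul0r oppr0 expR0 mul1e.
Qed.

Lemma mixing_prob_exists : exists nu : probability (measurableTypeR R) R,
  forall A, nu A = (\int[leb]_(z in A) (mixing_pdf z)%:E)%E.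
Proof.
exact: (density_probability measurable_mixing_pdf mixing_pdf_ge0 mixing_pdf_integral1).
Qed.

Variable nu : probability (measurableTypeR R) R.
Hypothesis nuE : forall A, nu A = (\int[leb]_(z in A) (mixing_pdf z)%:E)%E.

Lemma ge0_integral_mixing (f : measurableTypeR R -> \bar R) :
  measurable_fun setT f -> (forall z, (0 <= f z)%E) ->
  (\int[nu]_z f z = \int[leb]_z (f z * (mixing_pdf z)%:E))%E.
Proof.
move=> mf f0.
exact: (ge0_integral_density measurable_mixing_pdf mixing_pdf_ge0 (fun A _ => nuE A)).
Qed.

Lemma mixing_laplace (c : R) : 0 <= c ->
  (\int[nu]_z (expR (- (c * z `^ theta)))%:E = ((1 + c) `^ (- p))%:E)%E.
Proof.
move=> c0; rewrite ge0_integral_mixing ?laplace_leb//.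
  apply/measurable_EFinP; apply: measurableT_comp; first exact: measurable_expR.
  by apply: measurable_funN; apply: measurable_funM.
Qed.

End mixing_law.

Lemma uniform_cdf {R : realType} d (T : measurableType d) (P : probability T R)
    (U : {RV P >-> R}) : has_law U (uniform_prob (@ltr01 R)) ->
  forall x, fine (cdf U x) = Num.min 1 (Num.max 0 x).
Proof.
move=> hU x; rewrite /cdf hU// /uniform_prob integral_uniform_pdf.
have -> : (\int[lebesgue_measure]_(y in `]-oo, x] `&` `[0%R, 1%R]) (uniform_pdf 0 1 y)%:E =
   \int[lebesgue_measure]_(y in `]-oo, x] `&` `[0%R, 1%R]) 1%:E :> \bar R)%E.
  apply: eq_integral => y; rewrite inE/= => -[_]; rewrite in_itv/= => y01.
  by rewrite /uniform_pdf y01 subr0 invr1.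
rewrite integral_cst/=; last exact: measurableI.
rewrite mul1e; have [x0|x0] := ltP x 0.
  rewrite min_r// (_ : _ `&` _ = set0) ?measure0//.
  apply/seteqP; split => // y /=; rewrite !in_itv/= => -[yx /andP[y0 _]].
  by have := lt_le_trans x0 (le_trans y0 yx); rewrite ltxx.
have [x1|x1] := leP x 1.
  rewrite (_ : _ `&` _ = `[0, x]%classic).
    rewrite lebesgue_measure_itv/= lte_fin.
    have [->|xn0] := eqVneq x 0; first by rewrite ltxx.
    by rewrite lt_def xn0 x0 sube0.
  apply/seteqP; split => y /=; rewrite !in_itv/=; first by move=> [-> /andP[->]].
  by move=> /andP[-> yx]; rewrite yx (le_trans yx).
rewrite (_ : _ `&` _ = `[0, 1]%classic).
  by rewrite lebesgue_measure_itv/= lte_fin ltr01 sube0.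
apply/seteqP; split => y /=; rewrite !in_itv/=; first by case.
by move=> /andP[-> y1]; rewrite y1 (le_trans y1)// ltW.
Qed.

Section model.
Context {R : realType} {m : nat} d (T : measurableType d) (Q : probability T R).
Variable E : 'I_m -> {RV Q >-> R}.
Hypothesis E_iid : iid_exp1 E.
Variable theta : R.
Hypothesis theta0 : 0 < theta.
Let p := theta^-1.
Let p0 : 0 < p. Proof. by rewrite invr_gt0. Qed.
Let one_powR : (1 : R) `^ theta = 1. Proof. by rewrite powR1. Qed.
Let thp : theta * p = 1. Proof. by rewrite mulfV// gt_eqF. Qed.
Variable nu : probability (measurableTypeR R) R.
Hypothesis nu_integral : forall f : measurableTypeR R -> \bar R,
  measurable_fun setT f -> (forall z, (0 <= f z)%E) ->
  (\int[nu]_z f z = \int[lebesgue_measure]_z (f z * (mixing_pdf theta z)%:E))%E.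
Hypothesis nu_laplace : forall c, 0 <= c ->
  (\int[nu]_z (expR (- (c * z `^ theta)))%:E = ((1 + c) `^ (- p))%:E)%E.

Definition pos_part (i : 'I_m) (s : T) : R := Num.max (E i s) 0.

Lemma measurable_pos_part i : measurable_fun setT (pos_part i).
Proof. by apply: measurable_maxr => //; exact: (measurable_funP (E i)). Qed.

Lemma pos_part_ge0 i s : 0 <= pos_part i s.
Proof. by rewrite le_max lexx orbT. Qed.

(* Marshall-Olkin representation with frailty [z `^ theta]; the positive part makes
   the formula meaningful everywhere. *)
Definition model (i : 'I_m) (u : T * measurableTypeR R) : R :=
  u.2 / (u.2 `^ theta + pos_part i u.1) `^ p.

Lemma measurable_model i : measurable_fun setT (model i).
Proof.
apply: measurable_funM; first exact: measurable_snd.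
apply: (measurableT_comp measurable_invr).
apply: (measurableT_comp (measurable_powR _)); apply: measurable_funD.
  exact: (measurableT_comp (measurable_powR _) measurable_snd).
exact: (measurableT_comp (measurable_pos_part i) measurable_fst).
Qed.

Let tail_pos_part i (c : R) : 0 <= c ->
  Q (E i @^-1` [set x | c <= Num.max x 0]) = (expR (- c))%:E.
Proof.
rewrite le_eqVlt => /predU1P[<-|c0].
  rewrite oppr0 expR0 (_ : _ @^-1` _ = setT) ?probability_setT//.
  by apply/seteqP; split => // s _ /=; rewrite le_max lexx orbT.
rewrite -(exp_law_ccdf (exp1_law E_iid i)) ?(ltW c0)//; congr (Q _).
apply/seteqP; split => s /=; rewrite in_itv/= andbT le_max.
  by rewrite [c <= 0]leNgt c0 orbF.
by move=> ->.
Qed.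

Let measurable_tail (c : R) : measurable [set x : R | c <= Num.max x 0].
Proof.
rewrite (_ : mkset _ = (fun x : R => Num.max x 0) @^-1` `[c, +oo[).
  rewrite -[X in measurable X]setTI.
  have mm : measurable_fun setT (fun x : R => Num.max x 0) by apply: measurable_maxr.
  exact: mm.
by apply/seteqP; split => x /=; rewrite in_itv/= andbT.
Qed.

Lemma joint_tail (c : 'I_m -> R) : (forall i, 0 <= c i) ->
  Q [set s | forall i, c i <= pos_part i s] = (expR (- \sum_(i < m) c i))%:E.
Proof.
move=> c0.
have := E_iid.1 (finset.setTfor _) (fun i => [set x : R | c i <= Num.max x 0])
  (fun i => measurable_tail (c i)).
rewrite (_ : [set s | _] = [set s | forall i, c i <= pos_part i s]); last first.
  by apply/seteqP; split => s H i; [have := H i; rewrite inE; exact|move=> _; exact: H].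
move=> ->; rewrite -sumrN expR_sum -prodEFin.
under eq_bigl do rewrite inE.
by apply: eq_bigr => i _; exact: tail_pos_part.
Qed.

(** Raise to the power theta and solve for the exponential variable. For x >= 1 both sides hold, the
    threshold being 0 after truncation by the minimum. *)
Let model_le i s z (x : R) : 0 < z -> 0 < x ->
  (model i (s, z) <= x) =
  (z `^ theta * (Num.min 1 x `^ (- theta) - 1) <= pos_part i s).
Proof.
move=> z0 x0; rewrite /model/=.
have N0 := pos_part_ge0 i s; move: (pos_part i s) N0 => N N0.
have zt : 0 < z `^ theta by exact: powR_gt0.
have zE : z = (z `^ theta) `^ p by rewrite -powRrM thp powRr1// ltW.
have D0 : 0 < z `^ theta + N by rewrite ltr_pwDl.
rewrite ler_pdivrMr ?powR_gt0//.
have xt : 0 < x `^ theta by exact: powR_gt0.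
have -> : (z <= x * (z `^ theta + N) `^ p) = (z `^ theta <= x `^ theta * (z `^ theta + N)).
  have xE : x = (x `^ theta) `^ p by rewrite -powRrM thp powRr1// ltW.
  rewrite {1}zE {1}xE -powRM ?(ltW D0) ?(ltW xt)//.
  move: (z `^ theta) (x `^ theta * (z `^ theta + N)) (ltW zt) (mulr_gt0 xt D0).
  move=> a b a0 b0; apply/idP/idP => ab; last first.
    by apply: ge0_ler_powR; rewrite ?nnegrE ?(ltW b0) ?(ltW p0).
  rewrite leNgt; apply/negP => ba.
  have : b `^ p < a `^ p by apply: gt0_ltr_powR; rewrite ?nnegrE ?(ltW b0).
  by rewrite ltNge ab.
have [x1|x1] := leP 1 x.
  rewrite powR1 subrr mulr0 N0.
  have : 1 <= x `^ theta.
    by rewrite -[leLHS]one_powR; apply: ge0_ler_powR; rewrite ?nnegrE ?(ltW x0) ?(ltW theta0).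
  move: (z `^ theta) (x `^ theta) zt D0 => a b a0 aN b1.
  by rewrite (@le_trans _ _ (a + N)) ?lerDl// ler_peMl// ltW.
rewrite powRN.
move: (z `^ theta) (x `^ theta) zt xt => a b a0 b0.
by rewrite mulrBr mulr1 lerBlDl ler_pdivrMr// mulrC.
Qed.

(** Given z, the event is a joint tail of independent exponentials, with probability exp(-c z^theta)
    for c the sum of the y_i^(-theta) - 1. The Laplace transform of [nu] at c is the Clayton
    copula. *)
Lemma model_cdf (x : 'I_m -> R) :
  (Q \x nu)%E [set u | forall i, model i u <= x i] =
  (clayton theta (fun i => Num.min 1 (Num.max 0 (x i))))%:E.
Proof.
set X := [set u | _].
have mX : measurable X.
  rewrite (_ : X = (vec (fun i u => model i u)) @^-1` (lower_box x))//.
  rewrite -[Y in measurable Y]setTI; apply: measurable_vec => //.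
  - exact: measurable_model.
  - by apply: sub_sigma_algebra; exists x.
have mind : measurable_fun setT (fun u : T * measurableTypeR R => (\1_X u)%:E : \bar R).
  by apply/measurable_EFinP/measurable_indic.
have ind0 (u : T * measurableTypeR R) : (0 <= (\1_X u)%:E :> \bar R)%E by rewrite lee_fin.
transitivity (\int[(Q \x nu)%E]_u (\1_X u)%:E)%E.
  by rewrite integral_indic// setIT.
rewrite (@fubini_tonelli2 _ _ _ _ _ Q nu _ mind ind0) nu_integral; last 2 first.
- exact: measurable_fun_fubini_tonelli_G.
- by move=> z; apply: integral_ge0.
rewrite integral_mixing_pdf.
pose y i := Num.min 1 (Num.max 0 (x i)).
(* When some y_i = 0 the event is empty because the model is positive, in agreement with the value 0
   of [clayton] on those faces. *)
have QX z : 0 < z -> (\int[Q]_s (\1_X (s, z))%:E)%E =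
    if [exists i, y i == 0] then 0%E
    else (expR (- ((\sum_(i < m) (y i `^ (- theta) - 1)) * z `^ theta)))%:E.
  move=> z0.
  have -> : (\int[Q]_s (\1_X (s, z))%:E)%E = Q [set s | forall i, model i (s, z) <= x i].
    rewrite (_ : mkset _ = ysection X z); last first.
      by apply/seteqP; split => s /=; rewrite /ysection/= inE.
    rewrite -[in RHS](setIT (ysection X z)) -integral_indic//; last exact: measurable_ysection.
    by apply: eq_integral => s _; rewrite !indicE mem_ysection.
  have yx i : (y i == 0) = (x i <= 0).
    rewrite /y; have [xi|xi] := leP (x i) 0; first by rewrite min_r// eqxx.
    by rewrite gt_eqF// lt_min ltr01.
  case: ifPn => [/existsP[i]|/existsPn y0].
    rewrite yx => xi.
    rewrite (_ : mkset _ = set0) ?measure0//; apply/seteqP; split => // s /= /(_ i).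
    apply/negP; rewrite -ltNge; apply: (le_lt_trans xi).
    by rewrite /model/= divr_gt0// powR_gt0// ltr_pwDl ?powR_gt0// pos_part_ge0.
  have x0 i : 0 < x i by have := y0 i; rewrite yx -ltNge.
  have yE i : y i = Num.min 1 (x i) by rewrite /y max_r// ltW.
  have yi0 i : 0 < y i by rewrite yE lt_min ltr01 x0.
  have yi1 i : y i <= 1 by rewrite yE ge_min lexx.
  have yt i : 0 <= y i `^ (- theta) - 1.
    rewrite powRN subr_ge0 invf_ge1 ?powR_gt0// -[leRHS]one_powR.
    by apply: ge0_ler_powR; rewrite ?nnegrE ?(ltW theta0) ?(ltW (yi0 i)).
  rewrite (_ : mkset _ = [set s | forall i,
      z `^ theta * (y i `^ (- theta) - 1) <= pos_part i s]).
    by rewrite joint_tail -?mulr_sumr 1?mulrC// => i; rewrite mulr_ge0 ?powR_ge0.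
  by apply/seteqP; split => s /= H i; have := H i; rewrite yE model_le.
rewrite /clayton -/y.
case: ifPn QX => [_|/existsPn y0] QX.
  by rewrite integral0_eq// => z /=; rewrite in_itv/= andbT => z0; rewrite /fubini_G QX// mul0e.
pose c := \sum_(i < m) (y i `^ (- theta) - 1).
have c0 : 0 <= c.
  apply: sumr_ge0 => i _; rewrite powRN subr_ge0 invf_ge1; last first.
    have yi : 0 <= y i by rewrite /y le_min ler01 le_max lexx.
    by apply: powR_gt0; rewrite lt_neqAle eq_sym y0.
  have yi : 0 <= y i by rewrite /y le_min ler01 le_max lexx.
  rewrite -[leRHS]one_powR; apply: ge0_ler_powR; rewrite ?nnegrE ?(ltW theta0)//.
  by rewrite /y ge_min lexx.
have -> : \sum_(i < m) y i `^ (- theta) - m%:R + 1 = 1 + c.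
  by rewrite /c sumrB sumr_const card_ord addrC.
rewrite -nu_laplace// nu_integral; last 2 first.
- apply/measurable_EFinP; apply: measurableT_comp; first exact: measurable_expR.
  by apply: measurable_funN; apply: measurable_funM => //; exact: measurable_powR.
- by move=> z; rewrite lee_fin expR_ge0.
rewrite integral_mixing_pdf; apply: eq_integral => z; rewrite inE/= in_itv/= andbT => z0.
by rewrite /fubini_G QX.
Qed.

End model.

(** * Passing from the copula to the model *)

Section transfer.
Context {R : realType} {m : nat} d (T : measurableType d) (P : probability T R).
Context d' (T' : measurableType d') (Q : probability T' R).
Variables (U : 'I_m -> {RV P >-> R}) (E : 'I_m -> {RV Q >-> R}).
Variable theta : R.
Hypothesis theta0 : 0 < theta.
Hypothesis U_unif : forall i, has_law (U i) (uniform_prob (@ltr01 R)).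
Hypothesis U_clayton : has_copula U (@clayton R theta m).
Variable nu : probability (measurableTypeR R) R.
Hypothesis model_cdfE : forall x : 'I_m -> R,
  (Q \x nu)%E [set u | forall i, model E theta i u <= x i] =
  (clayton theta (fun i => Num.min 1 (Num.max 0 (x i))))%:E.

Lemma clayton_law (B : set (vecR R m)) : measurable B ->
  P (vec (fun i => U i) @^-1` B) = (Q \x nu)%E (vec (model E theta) @^-1` B).
Proof.
move=> mB.
have mU : measurable_fun setT (vec (fun i => U i : T -> R)).
  by apply: measurable_vec => i; exact: measurable_funP.
have mM : measurable_fun setT (vec (model E theta)).
  by apply: measurable_vec => i; exact: measurable_model.
pose m1 : {measure set (vecR R m) -> \bar R} :=
  pushforward P (vec (fun i => U i : T -> R)).
pose m2 : {measure set (vecR R m) -> \bar R} :=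
  pushforward (Q \x nu)%E (vec (model E theta)).
have := @vec_measure_unique R m (m1 mU) (m2 mM).
rewrite /m1 /m2 /= /pushforward; apply => // a.
  apply: (@le_lt_trans _ _ 1%E); last exact: ltry.
  apply: probability_le1; rewrite -[X in measurable X]setTI; apply: mU => //.
  by apply: sub_sigma_algebra; exists a.
transitivity (P [set s | forall i, U i s <= a i]); first exact: erefl.
rewrite U_clayton.
transitivity ((Q \x nu)%E [set u | forall i, model E theta i u <= a i]); last exact: erefl.
rewrite model_cdfE; congr (clayton _ _)%:E; apply/funext => i.
by rewrite uniform_cdf.
Qed.

Variable w : 'I_m -> R.

Definition model_tail (t : R) : set (T' * measurableTypeR R) :=
  [set u | t < \sum_(i < m) w i * (model E theta i u)^-1].

Lemma measurable_model_tail t : measurable (model_tail t).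
Proof.
have mS : measurable_fun setT
    (fun u => \sum_(i < m) w i * (model E theta i u)^-1).
  apply: measurable_sum => i; apply: measurable_funM => //.
  exact: (measurableT_comp measurable_invr (measurable_model E theta i)).
rewrite (_ : model_tail t =
  (fun u => \sum_(i < m) w i * (model E theta i u)^-1) @^-1` `]t, +oo[).
  by rewrite -[X in measurable X]setTI; exact: mS.
by apply/seteqP; split => u; rewrite /model_tail/= in_itv/= andbT.
Qed.

Lemma clayton_tail (t : R) :
  P [set s | t < \sum_(i < m) w i * (U i s)^-1] =
  (\int[Q]_s nu (xsection (model_tail t) s))%E.
Proof.
pose B : set (vecR R m) := [set x | t < \sum_(i < m) w i * (x i)^-1].
have mB : measurable B.
  have mS : measurable_fun setT (fun x : vecR R m => \sum_(i < m) w i * (x i)^-1).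
    apply: measurable_sum => i; apply: measurable_funM => //.
    exact: (measurableT_comp measurable_invr (measurable_coord i)).
  rewrite (_ : B = (fun x : vecR R m => \sum_(i < m) w i * (x i)^-1) @^-1` `]t, +oo[).
    by rewrite -[X in measurable X]setTI; exact: mS.
  by apply/seteqP; split => u; rewrite /B/= in_itv/= andbT.
(* The product measure is by definition the integral of the [nu]-measures of sections, which is the
   conditioning on [E]. *)
exact: clayton_law mB.
Qed.

Hypothesis w_simplex : simplex w.
Hypothesis nuE : forall A,
  nu A = (\int[lebesgue_measure]_(z in A) (mixing_pdf theta z)%:E)%E.

(** On x > 0 the weighted sum is phi(x^theta)/x, so the section is []0, z[] there; on x <= 0 the
    density vanishes. *)
Lemma nu_model_tail (s : T') (t z : R) (e := fun i => E i s) :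
  (forall i, 0 < e i) -> 0 < t -> 0 < z -> t * z = phi theta w e (z `^ theta) ->
  nu (xsection (model_tail t) s) = (a_ theta * gamma_cdf theta z)%:E.
Proof.
move=> e0 t0 z0 zE.
rewrite nuE integral_mkcond.
transitivity (\int[lebesgue_measure]_(x in `]0%R, z[)
    ((a_ theta)%:E * (expR (- x `^ theta))%:E))%E.
  rewrite [RHS]integral_mkcond; apply: eq_integral => x _.
  rewrite !patchE mem_xsection /mixing_pdf patchE.
  have [x0|x0] := ltP 0 x; last first.
    rewrite (memNset (A := `]0, +oo[%classic)) ?(memNset (A := `]0, z[%classic)).
    - by case: ifP.
    - by rewrite /= in_itv/= ltNge x0.
    - by rewrite /= in_itv/= ltNge x0.
  rewrite (mem_set (A := `]0, +oo[%classic)); last by rewrite /= in_itv/= x0.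
  rewrite EFinM (_ : ((s, x) \in model_tail t) = (x \in `]0, z[%classic))//.
  have H : (t < \sum_(i < m) w i * (model E theta i (s, x))^-1) = (x < z).
    rewrite -(crossingP theta0 w_simplex e0 z0 zE x0).
    rewrite -(ltr_pM2r x0) mulr_suml; congr (_ < _).
    apply: eq_bigr => i _; rewrite /model/= /pos_part max_l ?(ltW (e0 i))//.
    by rewrite invf_div -mulrA divfK// gt_eqF.
  by apply/idP/idP; rewrite !inE/= /model_tail/= in_itv/= x0 H.
have mE : measurable_fun setT (fun x : measurableTypeR R => (expR (- x `^ theta))%:E).
  by apply/measurable_EFinP; exact: measurable_expR_powR.
rewrite ge0_integralZl//; last 2 first.
- exact: measurable_funTS.
- rewrite lee_fin invr_ge0; apply: Rintegral_ge0 => x _.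
  by rewrite mulr_ge0 ?powR_ge0 ?expR_ge0.
rewrite integral_itv_bndo_bndc; last exact: measurable_funTS.
by rewrite gamma_cdfE// EFinM.
Qed.

End transfer.

(** * Tail asymptotics *)

Lemma near_infty_powR {R : realType} (theta K : R) : 0 < theta -> 0 < K ->
  \forall t \near +oo, K < t `^ theta.
Proof.
move=> theta0 K0; near=> t.
have tK : K `^ theta^-1 < t by near: t; exact: nbhs_pinfty_gt.
have -> : K = (K `^ theta^-1) `^ theta.
  by rewrite -powRrM mulVf ?gt_eqF// powRr1// ltW.
apply: gt0_ltr_powR; rewrite ?nnegrE ?powR_ge0//.
Unshelve. all: by end_near. Qed.

Section asymptotics.
Context {R : realType} {m : nat}.
Context d (T : measurableType d) (P : probability T R).
Context d' (T' : measurableType d') (Q : probability T' R).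
Variables (U : 'I_m -> {RV P >-> R}) (E : 'I_m -> {RV Q >-> R}).
Variables (theta : R) (w : 'I_m -> R).
Hypotheses (theta0 : 0 < theta) (w_simplex : simplex w).
Hypothesis U_unif : forall i, has_law (U i) (uniform_prob (@ltr01 R)).
Hypothesis U_clayton : has_copula U (@clayton R theta m).
Hypothesis E_iid : iid_exp1 E.
Let p := theta^-1.
Let p0 : 0 < p. Proof. by rewrite invr_gt0. Qed.
Let w0 : forall i, 0 <= w i := w_simplex.1.
Let a := a_ theta.
Let a0 : 0 < a := a_gt0 E_iid theta0 w_simplex.

Let tail t := fine (P [set s | t < \sum_(i < m) w i * (U i s)^-1]).

Variable nu : probability (measurableTypeR R) R.
Hypothesis nuE : forall A,
  nu A = (\int[lebesgue_measure]_(z in A) (mixing_pdf theta z)%:E)%E.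
Hypothesis model_cdfE : forall x : 'I_m -> R,
  (Q \x nu)%E [set u | forall i, model E theta i u <= x i] =
  (clayton theta (fun i => Num.min 1 (Num.max 0 (x i))))%:E.

Definition cond_tail (t : R) (s : T') : R :=
  fine (nu (xsection (model_tail E theta w t) s)).

Let nu_fin t s : nu (xsection (model_tail E theta w t) s) \is a fin_num.
Proof.
apply: fin_num_measure; apply: measurable_xsection.
exact: measurable_model_tail.
Qed.

Lemma measurable_cond_tail t : measurable_fun setT (cond_tail t).
Proof.
apply/measurable_EFinP; rewrite (_ : _ \o _ =
  nu \o xsection (model_tail E theta w t)).
  by apply: measurable_fun_xsection; exact: measurable_model_tail.
by apply/funext => s /=; rewrite /cond_tail fineK.
Qed.

Lemma cond_tail_itv t s : 0 <= cond_tail t s <= 1.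
Proof.
rewrite fine_ge0//= -lee_fin fineK//; apply: probability_le1.
by apply: measurable_xsection; exact: measurable_model_tail.
Qed.

Lemma integrable_cond_tail t : Q.-integrable setT (EFin \o cond_tail t).
Proof.
apply: (@le_integrableR _ _ _ _ _ (fun=> 1)); first exact: measurable_cond_tail.
- by move=> s; have /andP[? ?] := cond_tail_itv t s; rewrite ger0_norm.
- exact: finite_measure_integrable_cst.
Qed.

Definition scaled_error (t : R) (s : T') : R :=
  t `^ (1 + theta) * (cond_tail t s - t^-1 * (a * Aw theta w E s)).

Let integrable_Aw : Q.-integrable setT (EFin \o Aw theta w E).
Proof.
apply: integrableR_sum => i; apply: integrableRZ.
exact: integrable_exp_powR.
Qed.

(** The subtracted term has expectation exactly 1/t, so a pointwise limit of [scaled_error] carries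
    the whole second-order term. *)
Lemma Rintegral_scaled_error t : (\int[Q]_s (scaled_error t s))%R =
  t `^ (1 + theta) * (tail t - t^-1).
Proof.
have iA := integrableRZ t^-1 (integrableRZ a integrable_Aw).
rewrite RintegralZl//; last first.
  rewrite (_ : _ \o _ = fun s => ((cond_tail t s)%:E - (t^-1 * (a * Aw theta w E s))%:E)%E).
    by apply: integrableB => //; exact: integrable_cond_tail.
  by apply/funext => s /=; rewrite EFinB.
rewrite RintegralB//; last exact: integrable_cond_tail.
congr (_ * (_ - _)).
  rewrite /Rintegral /tail (clayton_tail U_unif U_clayton model_cdfE); congr fine.
  by apply: eq_integral => s _; rewrite /cond_tail fineK.
rewrite RintegralZl//; last exact: integrableRZ.
rewrite RintegralZl// /Rintegral (expectation_Aw E_iid theta0 w_simplex)/=.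
by rewrite /a /a_ mulVf ?mulr1// gt_eqF// -invr_gt0.
Qed.

Let good (s : T') := forall i, 0 < E i s.

Let phi0E s : phi theta w (fun i => E i s) 0 = Aw theta w E s.
Proof. by apply: eq_bigr => i _; rewrite add0r. Qed.

Let totalE s : good s -> \sum_(i < m) E i s = total E s.
Proof. by move=> gs; apply: eq_bigr => i _; rewrite powRr1// ltW. Qed.

Let scaled_errorE s t : good s -> 0 < t -> 2 <= t `^ theta ->
  exists z, [/\ 0 < z, t * z = phi theta w (fun i => E i s) (z `^ theta) &
    scaled_error t s = a * remainder theta w (fun i => E i s) (z `^ theta)].
Proof.
move=> gs t0 t2.
have [z z0 zE] := crossing_exists theta0 w_simplex gs t0 t2.
exists z; split => //.
rewrite -(remainderE theta0 t0 z0 zE) phi0E.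
rewrite /scaled_error /cond_tail (nu_model_tail theta0 w_simplex nuE gs t0 z0 zE)/=.
rewrite -/a; ring.
Qed.

(** [remainder_bound] multiplied out with 2M (2M)^(p-1) = (2M)^p, so that no negative power of
    [total] remains. *)
Definition error_bound (s : T') : R := a * (2 * (total E s * Bw theta w E s) +
  p * 2 `^ p * total E s `^ p + 2 `^ (1 + p) * total E s `^ (1 + p)).

Lemma integrable_error_bound : Q.-integrable setT (EFin \o error_bound).
Proof.
have i1 := integrableRZ 2 (integrable_totalBw E_iid theta0 w_simplex).
have i2 := integrableRZ (p * 2 `^ p) (integrable_total_powR E_iid p0).
have i3 := integrableRZ (2 `^ (1 + p)) (integrable_total_powR E_iid (addr_gt0 ltr01 p0)).
apply: integrableRZ; exact: (integrableD measurableT (integrableD measurableT i1 i2) i3).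
Qed.

Let scaled_error_bound s t : good s -> 0 < t -> 2 <= t `^ theta ->
  `|scaled_error t s| <= error_bound s.
Proof.
move=> gs t0 t2; have [z [z0 zE ->]] := scaled_errorE gs t0 t2.
rewrite normrM (ger0_norm (ltW a0)) /error_bound ler_pM2l//.
apply: (le_trans (remainder_bound theta0 w_simplex gs t0 t2 z0 zE)).
rewrite (totalE gs) -/(Bw theta w E s).
have M0 := total_ge0 E s; move: (total E s) M0 => M M0.
rewrite lerD//; last first.
  by rewrite -[M *+ 2]mulr_natl powRM.
rewrite mulrDr lerD//; first by rewrite -[M *+ 2]mulr_natl mulrA.
have -> : M *+ 2 * (p * (M *+ 2) `^ (p - 1)) = p * (M *+ 2) `^ p.
  by rewrite mulrCA mulr_powRB1// mulrn_wge0.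
by rewrite -[M *+ 2]mulr_natl powRM// mulrA.
Qed.

(** The root z depends on t, but [crossing_le] forces z^theta <= 2 total / t^theta, which tends to
    0, so the right limit of [remainder] applies. *)
Let cvg_scaled_error s : good s ->
  scaled_error t s @[t --> +oo] --> a * D_integrand theta w E s.
Proof.
move=> gs.
have DE : D_integrand theta w E s = phi theta w (fun i => E i s) 0 `^ theta *
    (p * \sum_(i < m) w i * E i s `^ (p - 1))
    - phi theta w (fun i => E i s) 0 `^ (theta + 1) * (theta + 1)^-1.
  rewrite phi0E /D_integrand -/(Bw theta w E s) /b_.
  have A0 : 0 < Aw theta w E s by rewrite -phi0E; exact: phi_gt0.
  rewrite powRD ?(gt_eqF A0) ?implybT// powRr1 ?(ltW A0)// [1 + theta]addrC.
  ring.
have := cvg_remainder theta0 w_simplex gs; rewrite -DE => /cvgrPdist_lt H.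
apply/cvgrPdist_lt => eps eps0.
have [|delta /= delta0 Hd] := H (eps / a); first by rewrite divr_gt0.
have M0 : 0 <= total E s by exact: total_ge0.
near=> t.
have t0 : 0 < t by near: t; exact: nbhs_pinfty_gt.
have t2 : 2 <= t `^ theta.
  by apply: ltW; near: t; exact: near_infty_powR.
have [z [z0 zE ->]] := scaled_errorE gs t0 t2.
rewrite -mulrBr normrM (gtr0_norm a0) mulrC -ltr_pdivlMr//.
apply: Hd; last exact: powR_gt0.
rewrite /= sub0r normrN gtr0_norm ?powR_gt0//.
have := crossing_le theta0 w_simplex gs t0 t2 z0 zE.
rewrite (totalE gs) => H1.
have : z `^ theta <= total E s *+ 2 / t `^ theta.
  by rewrite ler_pdivlMr ?powR_gt0// mulrC.
move/le_lt_trans; apply; rewrite ltr_pdivrMr ?powR_gt0// mulrC -ltr_pdivrMr//.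
(* The added 1 makes the threshold positive using only that [total] is nonnegative. *)
apply: (@lt_trans _ _ (total E s *+ 2 / delta + 1)); first by rewrite ltrDl.
near: t; apply: near_infty_powR => //.
by rewrite ltr_wpDl// divr_ge0// ?mulrn_wge0// ltW.
Unshelve. all: by end_near. Qed.

Let cvg_seq (u : R^nat) : u n @[n --> \oo] --> +oo ->
  u n `^ (1 + theta) * (tail (u n) - (u n)^-1) @[n --> \oo] --> D_coef theta w E.
Proof.
move=> uy.
pose c n := (0 < u n) && (2 <= u n `^ theta).
have cn : \forall n \near \oo, c n.
  have u1 : \forall n \near \oo, 0 < u n.
    by apply: (uy (fun t => 0 < t)); exact: nbhs_pinfty_gt.
  have u2 : \forall n \near \oo, 2 < u n `^ theta.
    by apply: (uy (fun t => 2 < t `^ theta)); exact: near_infty_powR.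
  near=> n; apply/andP; split; first by near: n.
  by apply: ltW; near: n.
(* Domination is required for every [n], whereas the bound holds only once [u n] is large; the
   finitely many other terms are replaced by 0. *)
pose g n s := if c n then scaled_error (u n) s else 0.
have mD := integrableRZ a (integrable_D_integrand E_iid theta0 w0).
have mg n : measurable_fun setT (EFin \o g n).
  apply/measurable_EFinP; rewrite /g; case: (c n) => //.
  apply: measurable_funM => //; apply: measurable_funB.
    exact: measurable_cond_tail.
  apply: measurable_funM => //; apply: measurable_funM => //.
  exact: measurable_Aw.
have [||_ _ H] := dominated_convergence measurableT mg (measurable_int _ mD) _
  integrable_error_bound _.
- apply: filterS (ae_exp1_gt0 E_iid) => s gs _.
  apply: cvg_EFin; first exact: nearW.
  have H := cvg_comp _ _ uy (cvg_scaled_error gs).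
  apply: cvg_trans H; apply: near_eq_cvg.
  by apply: filterS cn => n cn; rewrite /= /g cn.
- apply: filterS (ae_exp1_gt0 E_iid) => s gs n _.
  rewrite /= lee_fin /g; case: ifPn => [/andP[u0 u2]|_].
    exact: scaled_error_bound.
  (* Nonnegativity of [error_bound] follows from the bound at t = 2^p, where t^theta = 2 is just
     admissible. *)
  rewrite normr0; have := @scaled_error_bound s (2 `^ p) gs.
  move=> /(_ (powR_gt0 _ _)) K; apply: (le_trans (normr_ge0 _) (K _ _)) => //.
  by rewrite -powRrM mulrC mulfV ?gt_eqF// powRr1.
have -> : D_coef theta w E = fine (\int[Q]_s (a * D_integrand theta w E s)%:E)%E.
  rewrite /D_coef unlock.
  exact/esym/(RintegralZl a measurableT (integrable_D_integrand E_iid theta0 w0)).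
have fD : (\int[Q]_s (a * D_integrand theta w E s)%:E)%E \is a fin_num.
  exact: (integrable_fin_num measurableT mD).
move: H; rewrite -[X in _ --> X](fineK fD) => /fine_cvgP[_] H.
apply: cvg_trans H; apply: near_eq_cvg; apply: filterS cn => n cn.
rewrite /= -(Rintegral_scaled_error (u n)) /Rintegral; congr fine.
by apply: eq_integral => s _; rewrite /g cn.
Unshelve. all: by end_near. Qed.

Lemma cvg_scaled_tail :
  t `^ (1 + theta) * (tail t - t^-1) @[t --> +oo] --> D_coef theta w E.
Proof. by apply/cvg_pinftyP => u uy; exact: cvg_seq. Qed.

End asymptotics.

Lemma simplex_index {R : realType} (m : nat) (w : 'I_m -> R) : simplex w -> 'I_m.
Proof.
case: m w => [|m] w; last by move=> _; exact: ord0.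
by move=> [_]; rewrite big_ord0 => /esym/eqP; rewrite oner_eq0.
Qed.

Unset Implicit Arguments.

Theorem mainTheorem12 (R : realType) (m : nat) (theta : R) (w : 'I_m -> R)
    (d : measure_display) (T : measurableType d) (P : probability T R)
    (U : 'I_m -> {RV P >-> R})
    (d' : measure_display) (T' : measurableType d') (Q : probability T' R)
    (E : 'I_m -> {RV Q >-> R})
    (theta_gt0 : 0 < theta) (w_simplex : simplex w)
    (U_unif : forall i, has_law (U i) (uniform_prob (@ltr01 R)))
    (U_clayton : has_copula U (@clayton R theta m))
    (E_iid : iid_exp1 E) :
  (Q.-integrable setT (EFin \o D_integrand theta w E)
   /\ Q.-integrable setT (EFin \o D_integrand_alt theta w E))
  /\ (forall t : R,
        fine (P [set s | t < \sum_(i < m) w i * (U i s)^-1])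
        = t^-1 + D_coef theta w E * t `^ (- 1 - theta)
          +o_(t \near +oo%R) (t `^ (- 1 - theta)))
  /\ D_coef theta w E
     = a_ theta / (theta + 1) * fine 'E_Q[D_integrand_alt theta w E]
  /\ ((2 <= #|[pred i | (0 < w i)%R]|)%N -> 0 < D_coef theta w E)
  /\ (#|[pred i | w i != 0]| = 1%N -> D_coef theta w E = 0).
Proof.
have w0 := w_simplex.1.
(* Weights summing to 1 force m > 0; one exponential variable is needed for the Gamma facts behind
   [nu]. *)
have i := simplex_index w_simplex.
have G0 := Gamma_gt0 E_iid theta_gt0 i.
have iG := integral_expR_powR E_iid theta_gt0 i.
have [nu nuE] := mixing_prob_exists G0 iG.
have nuI := ge0_integral_mixing G0 nuE.
have nuL := mixing_laplace G0 iG nuE.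
have mE := model_cdf E_iid theta_gt0 nuI nuL.
split; first by split; [exact: integrable_D_integrand|exact: integrable_D_integrand_alt].
split; last first.
  split; first exact: (D_coefE E_iid).
  by split; [exact: (D_coef_gt0 E_iid)|exact: (D_coef_eq0 E_iid)].
pose f t := fine (P [set s | t < \sum_(i < m) w i * (U i s)^-1]).
pose g t := t^-1 + D_coef theta w E * t `^ (- 1 - theta).
pose h (t : R) := t `^ (- 1 - theta).
suff : f = g +o_ (pinfty_nbhs R) h.
  by move=> fg t; exact: (congr1 (fun k => k t) fg).
apply/eqaddoP => eps eps0.
have /cvgrPdist_le H := cvg_scaled_tail theta_gt0 w_simplex U_unif U_clayton E_iid nuE mE.
have {}H := H _ eps0.
near=> t.
have t0 : 0 < t by near: t; exact: nbhs_pinfty_gt.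
have : `|D_coef theta w E - t `^ (1 + theta) * (f t - t^-1)| <= eps by near: t.
have ht : 0 < h t by exact: powR_gt0.
have -> : t `^ (1 + theta) = (h t)^-1 by rewrite /h -powRN; congr (_ `^ _); ring.
move=> K.
have -> : (f - g) t = - ((D_coef theta w E - (h t)^-1 * (f t - t^-1)) * h t).
  have -> : (f - g) t = f t - (t^-1 + D_coef theta w E * h t) by [].
  by field; rewrite !gt_eqF.
by rewrite normrN normrM ler_wpM2r.
Unshelve. all: by end_near. Qed.
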